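(* Let $n\in\mathbb{N}$ and $\tau\in\mathcal{R}$ be such that there exists at least one choice of numbers $0=t_1<t_2<\dots<t_n$ with $\tau+t_n\le1$ almost everywhere. Set $m:=\operatorname{ess\,inf}_{w\in\Omega}\tau(w)$ and $M:=\operatorname{ess\,sup}_{w\in\Omega}\tau(w)$. For each such choice put $\tau_k:=\tau+t_k$, $k=1,\dots,n$ (with $t_1=0$), and let $\inf_{t_2,\dots,t_n}$ denote the infimum over all such choices. 1. If $(2n-1)m+M\ge1$, then $$\inf_{t_2,\dots,t_n}E(\tau_1,\dots,\tau_n)=(2n-1)I\left(\frac{1-M}{2n-1}\right)+I(M),$$ and the infimum is attained for $t_k=\frac{2(k-1)(1-M)}{2n-1}$, $k=2,\dots,n$. 2. If $(2n-1)M+m\le1$, then $$\inf_{t_2,\dots,t_n}E(\tau_1,\dots,\tau_n)=(2n-1)I\left(\frac{1-m}{2n-1}\right)+I(m),$$ and the infimum is attained for $t_k=\frac{2(k-1)(1-m)}{2n-1}$, $k=2,\dots,n$. 3. Otherwise, $$\inf_{t_2,\dots,t_n}E(\tau_1,\dots,\tau_n)=(2n-2)I\left(\frac{1-m-M}{2n-2}\right)+I(m)+I(M),$$ and the infimum is attained for $t_k=\frac{(k-1)(1-m-M)}{n-1}$, $k=2,\dots,n$.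
   Context: $(\Omega,\mathcal{F},P)$ is a fixed probability space and $\mathbb{E}$ denotes expectation. For a random variable $\eta$ on it, $\|\eta\|_\infty:=\operatorname{ess\,sup}_{w\in\Omega}|\eta(w)|$. $\mathcal{R}$ is the set of all random variables $\eta$ on $(\Omega,\mathcal{F},P)$ with $\eta(w)\in[0,1]$ for all $w\in\Omega$; a random variable with values in $[0,1]$ only almost everywhere is regarded as an element of $\mathcal{R}$ after modification on a null set. $\omega$ is a fixed concave modulus of continuity: a continuous non-decreasing concave function $\omega\colon[0,\infty)\to[0,\infty)$ with $\omega(0)=0$. For $t\ge0$, $I(t):=\int_0^t\omega(s)\,ds$. $\mathcal{H}^\omega$ is the class of all (jointly) measurable real-valued random processes $\xi_t$, $t\in[0,1]$, on $(\Omega,\mathcal{F},P)$ such that $\mathbb{E}|\xi_\tau-\xi_\theta|\le\omega(\|\tau-\theta\|_\infty)$ for all $\tau,\theta\in\mathcal{R}$, where $\xi_\tau$ is the random variable $w\mapsto\xi_{\tau(w)}(w)$. Given $\tau_1,\dots,\tau_n\in\mathcal{R}$, a method of recovery (of $\int_0^1\xi_t\,dt$ for $\xi\in\mathcal{H}^\omega$) is $S=S^\varphi_n(\xi;\tau_1,\dots,\tau_n)=\varphi(\xi_{\tau_1},\dots,\xi_{\tau_n})$, where $\varphi$ is an arbitrary mapping from $n$-tuples of real-valued random variables on $(\Omega,\mathcal{F},P)$ to real-valued random variables on $(\Omega,\mathcal{F},P)$. Its error is $$e(\tau_1,\dots,\tau_n;S):=\sup_{\xi\in\mathcal{H}^\omega}\mathbb{E}\left|\int_0^1\xi_t\,dt-S^\varphi_n(\xi;\tau_1,\dots,\tau_n)\right|,$$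 and $E(\tau_1,\dots,\tau_n):=\inf_Se(\tau_1,\dots,\tau_n;S)$, the infimum being over all methods of recovery. *)

(* Defs.v *)
From HB Require Import structures.
From mathcomp Require Import all_boot all_order all_algebra.
From mathcomp Require Import all_classical all_reals all_analysis.
From mathcomp Require Import measurable_realfun ess_sup_inf.

Set Implicit Arguments.
Unset Strict Implicit.
Unset Printing Implicit Defensive.

Import Order.TTheory GRing.Theory Num.Theory.
Import numFieldNormedType.Exports.

Local Open Scope classical_set_scope.
Local Open Scope ring_scope.

(* Only the values of w on [0, +oo[ are constrained (and used). *)
Record concave_modulus (R : realType) (w : R -> R) : Prop := ConcaveModulus {
  modulus_ge0 : forall x, 0 <= x -> 0 <= w x ;
  modulus0 : w 0 = 0 ;
  modulus_cont : {within `[0, +oo[, continuous w} ;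
  modulus_ndecr : forall x y, 0 <= x -> x <= y -> w x <= w y ;
  modulus_concave : forall x y l, 0 <= x -> 0 <= y -> 0 <= l <= 1 ->
    l * w x + (1 - l) * w y <= w (l * x + (1 - l) * y)
}.

Definition primitive_modulus (R : realType) (w : R -> R) (t : R) : R :=
  \int[lebesgue_measure]_(s in `[0, t]) w s.

(* The essential suprema and infima below are only taken of functions bounded
   a.e., for which [fine] does not lose information. *)
Definition linfty_norm d (T : measurableType d) (R : realType)
    (P : probability T R) (eta : T -> R) : R :=
  fine (ess_sup P (fun x => `|eta x|%:E)).

Record random_time d (T : measurableType d) (R : realType)
    (P : probability T R) := RandomTime {
  time_rv :> {mfun T >-> R} ;
  time_itv : forall x, 0 <= time_rv x <= 1
}.

Definition time_ess_inf d (T : measurableType d) (R : realType)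
    (P : probability T R) (tau : random_time P) : R :=
  fine (ess_inf P (fun x => (tau x)%:E)).

Definition time_ess_sup d (T : measurableType d) (R : realType)
    (P : probability T R) (tau : random_time P) : R :=
  fine (ess_sup P (fun x => (tau x)%:E)).

(* A process indexed by [0, 1]: the values at times outside [0, 1] are
   unconstrained and never used. *)
Record process d (T : measurableType d) (R : realType)
    (P : probability T R) := Process {
  process_fun :> R -> T -> R ;
  process_meas : measurable_fun ((`[0, 1]%classic : set R) `*` [set: T])
    (fun p : R * T => process_fun p.1 p.2)
}.

Section sampling.
Context d (T : measurableType d) (R : realType) (P : probability T R).
Variables (xi : process P) (tau : random_time P).

Definition sample_fun (x : T) : R := xi (tau x) x.

Lemma measurable_sample : measurable_fun [set: T] sample_fun.
Proof.
apply: (@measurable_comp _ _ _ _ _ _ ((`[0, 1]%classic : set R) `*` [set: T])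
  (fun p : R * T => xi p.1 p.2) setT (fun x => (tau x, x))).
- by apply: measurableX => //; exact: measurable_itv.
- move=> _ [x _ <-]; split => //=; rewrite in_itv /=; exact: time_itv.
- exact: process_meas.
- by apply: measurable_fun_pair.
Qed.

HB.instance Definition _ :=
  isMeasurableFun.Build _ _ _ _ sample_fun measurable_sample.

Definition sample : {RV P >-> R} := sample_fun.

End sampling.

Definition process_class d (T : measurableType d) (R : realType)
    (P : probability T R) (w : R -> R) : set (process P) :=
  [set xi | forall tau theta : random_time P,
    ('E_P[fun x => `|sample_fun xi tau x - sample_fun xi theta x|%R] <=
     (w (linfty_norm P (fun x => tau x - theta x)))%:E)%E].

Definition recovery_map d (T : measurableType d) (R : realType)
    (P : probability T R) (n : nat) : Type :=
  ('I_n -> {RV P >-> R}) -> {RV P >-> R}.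

(* For xi in the class, xi_t is a.s. integrable on [0, 1] (compare with xi_0),
   hence the value of the integral at the other points is irrelevant. *)
Definition recovery_error d (T : measurableType d) (R : realType)
    (P : probability T R) (w : R -> R) (n : nat)
    (taus : 'I_n -> random_time P) (phi : recovery_map P n) : \bar R :=
  ereal_sup [set
    'E_P[fun x => `|(\int[lebesgue_measure]_(t in `[0, 1]) xi t x) -
                    (phi (fun k => sample xi (taus k)) x : R)|%R]%E
    | xi in @process_class d T R P w].

Definition optimal_error d (T : measurableType d) (R : realType)
    (P : probability T R) (w : R -> R) (n : nat)
    (taus : 'I_n -> random_time P) : \bar R :=
  ereal_inf (range (@recovery_error d T R P w n taus)).

Section shift.
Context d (T : measurableType d) (R : realType) (P : probability T R).
Variables (tau : random_time P) (t : R).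

Definition shift_fun (x : T) : R := Num.max 0 (Num.min 1 (tau x + t)).

Lemma measurable_shift : measurable_fun [set: T] shift_fun.
Proof.
apply: measurable_maxr => //; apply: measurable_minr => //.
exact: measurable_funD.
Qed.

HB.instance Definition _ :=
  isMeasurableFun.Build _ _ _ _ shift_fun measurable_shift.

Lemma shift_itv (x : T) : 0 <= shift_fun x <= 1.
Proof. by rewrite /shift_fun le_max lexx /= ge_max ler01 ge_min lexx. Qed.

(* tau + t, truncated to [0, 1]; if t >= 0 and tau + t <= 1 a.e., this is a
   modification of tau + t on a null set. *)
Definition shift_time : random_time P :=
  @RandomTime _ _ _ P shift_fun shift_itv.

End shift.

(* Indices are shifted by one: t k stands for t_(k+1), k = 0, ..., n - 1. *)
Definition admissible d (T : measurableType d) (R : realType)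
    (P : probability T R) (n : nat) (tau : random_time P)
    (t : 'I_n -> R) : Prop :=
  [/\ forall k : 'I_n, k = 0%N :> nat -> t k = 0,
      forall j k : 'I_n, (j < k)%N -> t j < t k &
      forall k : 'I_n, k.+1 = n -> {ae P, forall x, tau x + t k <= 1}].

Definition shift_error d (T : measurableType d) (R : realType)
    (P : probability T R) (w : R -> R) (n : nat) (tau : random_time P)
    (t : 'I_n -> R) : \bar R :=
  optimal_error w (fun k => shift_time tau (t k)).

Definition inf_shift_error d (T : measurableType d) (R : realType)
    (P : probability T R) (w : R -> R) (n : nat)
    (tau : random_time P) : \bar R :=
  ereal_inf [set shift_error w tau t | t in @admissible d T R P n tau].

Definition inf_shift_error_attained d (T : measurableType d) (R : realType)
    (P : probability T R) (w : R -> R) (n : nat)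
    (tau : random_time P) (t : 'I_n -> R) : Prop :=
  admissible tau t /\ shift_error w tau t = inf_shift_error w n tau.

(* Main.v *)
Require Import Defs.
From HB Require Import structures.
From mathcomp Require Import all_boot all_order all_algebra.
From mathcomp Require Import all_classical all_reals all_analysis.
From mathcomp Require Import measurable_realfun ess_sup_inf zify lra.

(* Upper bound. For nodes [y k] at distance [2 h] from each other, the integral
   of the process is replaced by the sum of its values at the nodes weighted by
   the lengths of their Voronoi cells, which are random for the two end nodes
   only. Reparametrizing [[0, 1]] by the distance [s] to a node turns the error
   into averages over [s] of [E |xi_theta1 - xi_theta2|], where theta1, theta2
   are random times at distance at most [s], so that Tonelli gives integrals of
   the modulus. The two end pieces have random lengths whose sum is constant;
   the surplus of one of them is transferred to the other one, so that together
   they cost no more than at an extreme value of tau.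

   Lower bound. Concentrate the process on the event that tau is close to an
   essential extremum c: [xi_t = +- 1_A / P(A) * w(dist(t, nodes))] vanishes at
   all nodes, hence both signs have the same recovery, and the error is at least
   the integral of [w(dist(t, nodes))], which is a sum of values of the convex
   function I at the half-gaps and at the end pieces. Tangent lines of I bound
   it from below. *)

Set Implicit Arguments.
Unset Strict Implicit.
Unset Printing Implicit Defensive.

Import Order.TTheory GRing.Theory Num.Theory.
Import numFieldNormedType.Exports.

Local Open Scope classical_set_scope.
Local Open Scope ring_scope.

(** * Lebesgue integrals over intervals *)

Section lebesgue_affine.
Context {R : realType}.
Notation mu := (@lebesgue_measure R).
Implicit Types (g : R -> \bar R) (c a b : R).

(** The image of Lebesgue measure under a translation has the same values on half-open intervals,
    hence is Lebesgue measure by uniqueness; the equality is then the change of variables for image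
    measures. *)
Lemma ge0_integral_shift g c : measurable_fun setT g ->
  (forall x, 0 <= g x)%E ->
  (\int[mu]_x g (c + x)%R = \int[mu]_x g x)%E.
Proof.
move=> mg g0.
have mphi : measurable_fun [set: measurableTypeR R]
    (fun x : measurableTypeR R => c + x : measurableTypeR R).
  exact: measurable_funD.
rewrite -[LHS]/(\int[mu]_(x in (fun x => c + x)%R @^-1` setT)
  (g \o (fun x => c + x)%R) x)%E.
rewrite -(ge0_integral_pushforward mphi)//.
apply: eq_measure_integral => A mA _; apply/esym.
apply: (@lebesgue_measure_unique R (pushforward mu _)) => //.
move=> _ [[x y] /= _ <-]; rewrite /pushforward.
have -> : (fun z => c + z) @^-1` `]x, y] = `]x - c, y - c]%classic.
  by apply/seteqP; split => z /=; rewrite !in_itv/= ltrBlDl lerBrDl.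
rewrite !lebesgue_measure_itv/= !lte_fin ltrD2r; case: ifPn => // _.
by rewrite -!EFinB; congr (_%:E); lra.
Qed.

Lemma ge0_integral_reflect g c : measurable_fun setT g ->
  (forall x, 0 <= g x)%E ->
  (\int[mu]_x g (c - x)%R = \int[mu]_x g x)%E.
Proof.
move=> mg g0.
have mphi : measurable_fun [set: measurableTypeR R]
    (fun x : measurableTypeR R => c - x : measurableTypeR R).
  exact: measurable_funB.
rewrite -[LHS]/(\int[mu]_(x in (fun x => c - x)%R @^-1` setT)
  (g \o (fun x => c - x)%R) x)%E.
rewrite -(ge0_integral_pushforward mphi)//.
apply: eq_measure_integral => A mA _; apply/esym.
apply: (@lebesgue_measure_unique R (pushforward mu _)) => //.
move=> _ [[x y] /= _ <-]; rewrite /pushforward.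
have -> : (fun z => c - z) @^-1` `]x, y] = `[c - y, c - x[%classic.
  apply/seteqP; split => z /=; rewrite !in_itv/= => /andP[H1 H2]; apply/andP; split; lra.
rewrite !lebesgue_measure_itv/= !lte_fin ltrD2l ltrN2; case: ifPn => // _.
by rewrite -!EFinB; congr (_%:E); lra.
Qed.

Lemma ge0_integral_shift_itv g c a b : measurable_fun setT g ->
  (forall x, 0 <= g x)%E ->
  (\int[mu]_(x in `[a, b]) g (c + x)%R = \int[mu]_(x in `[(c + a)%R, (c + b)%R]) g x)%E.
Proof.
move=> mg g0; rewrite integral_mkcond [RHS]integral_mkcond.
rewrite -[RHS](@ge0_integral_shift _ c); last 2 first.
- by apply: (measurable_restrictT _ _).1 => //; exact: measurable_funTS.
- by move=> x; apply: erestrict_ge0.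
apply: eq_integral => x _; rewrite /restrict /= !mem_setE !in_itv/=.
by rewrite !lerD2l.
Qed.

Lemma ge0_integral_reflect_itv g c a b : measurable_fun setT g ->
  (forall x, 0 <= g x)%E ->
  (\int[mu]_(x in `[a, b]) g (c - x)%R = \int[mu]_(x in `[(c - b)%R, (c - a)%R]) g x)%E.
Proof.
move=> mg g0; rewrite integral_mkcond [RHS]integral_mkcond.
rewrite -[RHS](@ge0_integral_reflect _ c); last 2 first.
- by apply: (measurable_restrictT _ _).1 => //; exact: measurable_funTS.
- by move=> x; apply: erestrict_ge0.
apply: eq_integral => x _; rewrite /restrict /= !mem_setE !in_itv/=.
by rewrite !lerD2l !lerN2 andbC.
Qed.

End lebesgue_affine.

Section real_integral.
Context {R : realType}.
Notation mu := (@lebesgue_measure R).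
Implicit Types (f : R -> R) (a b c : R).

Lemma Rintegral_itv_split f a b c : a <= b -> b <= c ->
  mu.-integrable `[a, c] (EFin \o f) ->
  \int[mu]_(x in `[a, c]) f x =
  \int[mu]_(x in `[a, b]) f x + \int[mu]_(x in `[b, c]) f x.
Proof.
move=> ab bc fi.
have := @Rintegral_itvB R f (BLeft a) (BRight c) b fi.
rewrite !bnd_simp => /(_ ab bc); rewrite Rintegral_itv_obnd_cbnd; last first.
  by apply: integrableS fi => //; apply: subset_itvr; rewrite bnd_simp.
by move=> <-; rewrite addrC subrK.
Qed.

Lemma integrable_subitv f a b a' b' : a' <= a -> b <= b' ->
  mu.-integrable `[a', b'] (EFin \o f) -> mu.-integrable `[a, b] (EFin \o f).
Proof.
by move=> aa bb; apply: integrableS => //; apply: subset_itv; rewrite bnd_simp.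
Qed.

Lemma integrable_cst_itv a b c : mu.-integrable `[a, b] (EFin \o cst c).
Proof.
apply: measurable_bounded_integrable => //.
  by rewrite /= lebesgue_measure_itv/=; case: ifPn => // _; rewrite -EFinB ltry.
by exists `|c|; split; [exact: num_real|move=> y cy z _ /=; exact: ltW].
Qed.

Lemma Rintegral_cst_itv a b c : a <= b ->
  \int[mu]_(x in `[a, b]) c = (b - a) * c.
Proof.
move=> ab; rewrite Rintegral_cst//= lebesgue_measure_itv/= lte_fin mulrC.
have [_|ba] := ltP a b; first by rewrite -EFinB.
by have -> : b = a; [apply/eqP; rewrite eq_le ab ba|rewrite subrr].
Qed.

Lemma le_dist_Rintegral f a b c : a <= b ->
  mu.-integrable `[a, b] (EFin \o f) ->
  (`|\int[mu]_(x in `[a, b]) f x - (b - a) * c|%:E <=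
   \int[mu]_(x in `[a, b]) `|f x - c|%:E)%E.
Proof.
move=> ab fi.
have ci := integrable_cst_itv a b c.
have fci : mu.-integrable `[a, b] (EFin \o (fun x => f x - c)).
  by apply: eq_integrable (integrableB _ fi ci).
rewrite -Rintegral_cst_itv// -RintegralB// EFin_normr_Rintegral//.
apply: le_abse_integral => //.
exact: (measurable_int mu fci).
Qed.

Lemma integrable_itv_monotone f a b : nondecreasing_fun f ->
  mu.-integrable `[a, b] (EFin \o f).
Proof.
move=> fnd; apply: measurable_bounded_integrable => //.
- by rewrite /= lebesgue_measure_itv/=; case: ifPn => // _; rewrite -EFinB ltry.
- exact: nondecreasing_measurable.
exists (`|f a| + `|f b|); split; first exact: num_real.
move=> y cy z /=; rewrite in_itv/= => /andP[az zb].
have := fnd _ _ az; have := fnd _ _ zb.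
have := ler_norm (f b); have := ler_norm (- f a); rewrite normrN.
have := normr_ge0 (f a); have := normr_ge0 (f b).
by rewrite ler_norml => *; apply/andP; split; lra.
Qed.

End real_integral.

(** * The modulus of continuity and its primitive *)

Section modulus.
Context {R : realType} (w : R -> R).
Hypothesis hw : concave_modulus w.
Notation mu := (@lebesgue_measure R).
Local Notation I := (primitive_modulus w).
Implicit Types x y t : R.

(* The modulus is unconstrained on negative numbers; this makes it monotone
   on the whole line. *)
Definition modulus_ext x := w (Num.max 0 x).
Local Notation v := modulus_ext.

Lemma modulus_extE x : 0 <= x -> v x = w x.
Proof. by move=> x0; rewrite /v max_r. Qed.

Lemma modulus_ext_ndecr : nondecreasing_fun v.
Proof.
move=> x y xy; apply: (modulus_ndecr hw); first by rewrite le_max lexx.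
by rewrite ge_max !le_max lexx xy orbT.
Qed.

Lemma modulus_ext_ge0 x : 0 <= v x.
Proof. by apply: (modulus_ge0 hw); rewrite le_max lexx. Qed.

Lemma modulus_ext0 : v 0 = 0.
Proof. by rewrite modulus_extE// (modulus0 hw). Qed.

Lemma measurable_modulus_ext : measurable_fun setT v.
Proof. exact: nondecreasing_measurable modulus_ext_ndecr. Qed.

(** Subadditivity of a concave function vanishing at 0: for [0 <= t <= y] the chord gives
    [t / y * w y <= w t], and adding this for [t = x] and [t = y - x] yields
    [w y <= w x + w (y - x)]. *)
Lemma modulus_ext_dist x y : `|v x - v y| <= v `|x - y|.
Proof.
wlog xy : x y / x <= y => [H|].
  have [|/ltW yx] := leP x y; first exact: H.
  by rewrite distrC (distrC x); exact: H.
rewrite ler0_norm ?subr_le0 ?modulus_ext_ndecr// opprB distrC ger0_norm ?subr_ge0//.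
have [x0|x0] := leP x 0.
  have -> : v x = 0 by rewrite /v max_l// (modulus0 hw).
  by rewrite subr0; apply: modulus_ext_ndecr; lra.
have y0 : 0 < y by lra.
rewrite !modulus_extE; [|lra..].
have q (t : R) : 0 <= t <= y -> t / y * w y <= w t.
  move=> /andP[t0 ty].
  have := modulus_concave hw (ltW y0) (lexx 0) (l := t / y).
  rewrite (modulus0 hw) !mulr0 !addr0 mulfVK ?gt_eqF//; apply.
  by rewrite divr_ge0 ?(ltW y0)//= ler_pdivrMr// mul1r.
have := q x; have := q (y - x).
have -> : (y - x) / y * w y = w y - x / y * w y.
  by rewrite mulrBl divff ?gt_eqF// mulrBl mul1r.
move=> h1 h2; have := h1 ltac:(lra); have := h2 ltac:(lra); lra.
Qed.

Lemma primitive_modulusE t : I t = \int[mu]_(s in `[0, t]) v s.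
Proof.
apply: eq_Rintegral => s; rewrite inE/= in_itv/= => /andP[s0 _].
by rewrite modulus_extE.
Qed.

Lemma EFin_primitive_modulus t : (I t)%:E = (\int[mu]_(s in `[0%R, t]) (v s)%:E)%E.
Proof.
rewrite primitive_modulusE /Rintegral fineK//.
by apply: integrable_fin_num => //; exact: integrable_itv_monotone modulus_ext_ndecr.
Qed.

(** Between [x] and [y] the monotone modulus stays on one side of [w x], which is therefore the
    slope of a supporting line of the convex function [I]. *)
Lemma primitive_modulus_tangent x y : 0 <= x -> 0 <= y ->
  I x + w x * (y - x) <= I y.
Proof.
move=> x0 y0; rewrite !primitive_modulusE.
have vi a b := integrable_itv_monotone a b modulus_ext_ndecr.
have vc a b c := @integrable_cst_itv R a b c.
rewrite -[w x]modulus_extE//.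
have [xy|/ltW yx] := leP x y.
- rewrite (Rintegral_itv_split x0 xy)// lerD2l mulrC -Rintegral_cst_itv//.
  apply: le_Rintegral => //; first exact: vc.
  move=> s/=; rewrite in_itv/= => /andP[xs _].
  exact: modulus_ext_ndecr.
- rewrite (Rintegral_itv_split y0 yx)// -[leRHS]addr0 -addrA lerD2l.
  rewrite -(opprB x y) mulrN mulrC subr_le0 -Rintegral_cst_itv//.
  apply: le_Rintegral => //; first exact: vc.
  move=> s/=; rewrite in_itv/= => /andP[_ xs].
  exact: modulus_ext_ndecr.
Qed.

Lemma Rintegral_modulus_right a b : a <= b ->
  \int[mu]_(t in `[a, b]) v (t - a) = I (b - a).
Proof.
move=> ab; rewrite primitive_modulusE /Rintegral; congr fine.
have := @ge0_integral_shift_itv R (fun s => (v s)%:E) (- a) a b.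
rewrite (addrC (- a) b) addNr => <-.
- by apply: eq_integral => x _; rewrite addrC.
- by apply/measurable_EFinP; exact: measurable_modulus_ext.
- by move=> x; rewrite lee_fin modulus_ext_ge0.
Qed.

Lemma Rintegral_modulus_left a b : a <= b ->
  \int[mu]_(t in `[a, b]) v (b - t) = I (b - a).
Proof.
move=> ab; rewrite primitive_modulusE /Rintegral; congr fine.
have := @ge0_integral_reflect_itv R (fun s => (v s)%:E) b a b.
rewrite subrr => <- //.
- by apply/measurable_EFinP; exact: measurable_modulus_ext.
- by move=> x; rewrite lee_fin modulus_ext_ge0.
Qed.

End modulus.

(** * Upper bound *)

Section quadrature.
Context {R : realType}.
Notation mu := (@lebesgue_measure R).
Variable F : R -> R.
Hypothesis mF : measurable_fun setT F.
Hypothesis Fi : mu.-integrable `[0, 1] (EFin \o F).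
Implicit Types (a b c p : R).

Lemma measurable_dist_cst c : measurable_fun setT (fun t => `|F t - c|%:E).
Proof.
by apply/measurable_EFinP; apply: measurableT_comp => //; exact: measurable_funB.
Qed.

Lemma le_dist_shift a b c p : 0 <= a -> a <= b -> b <= 1 ->
  (`|\int[mu]_(t in `[a, b]) F t - (b - a) * c|%:E <=
   \int[mu]_(s in `[(a - p)%R, (b - p)%R]) `|F (p + s)%R - c|%:E)%E.
Proof.
move=> a0 ab b1; apply: (le_trans (le_dist_Rintegral _ _ _)) => //.
  exact: integrable_subitv Fi.
rewrite (@ge0_integral_shift_itv R (fun t => `|F t - c|%:E)%E)//.
  by rewrite ![(p + (_ - p))%R]addrC !subrK.
exact: measurable_dist_cst.
Qed.

Lemma le_dist_reflect a b c p : 0 <= a -> a <= b -> b <= 1 ->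
  (`|\int[mu]_(t in `[a, b]) F t - (b - a) * c|%:E <=
   \int[mu]_(s in `[(p - b)%R, (p - a)%R]) `|F (p - s)%R - c|%:E)%E.
Proof.
move=> a0 ab b1; apply: (le_trans (le_dist_Rintegral _ _ _)) => //.
  exact: integrable_subitv Fi.
rewrite (@ge0_integral_reflect_itv R (fun t => `|F t - c|%:E)%E)//.
  by rewrite !subKr.
exact: measurable_dist_cst.
Qed.

Variables (x : nat -> R) (h : R) (j : nat).
Hypothesis h0 : 0 <= h.
Hypothesis xS : forall k, (k < j)%N -> x k.+1 = x k + 2 * h.
Hypothesis x00 : 0 <= x 0%N.
Hypothesis xj1 : x j <= 1.

Lemma node_monotone i k : (i <= k <= j)%N -> x i <= x k.
Proof.
elim: k => [|k IH]; first by rewrite leqn0 => /andP[/eqP ->].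
rewrite leq_eqVlt ltnS => /andP[/predU1P[->//|ik] kj].
by rewrite xS//; have := IH ltac:(rewrite ik ltnW//); have := h0; lra.
Qed.

(** Induction on the gaps. Each gap is cut at its midpoint; the left half is parametrized by the
    distance to the left node and the right half, reflected, by the distance to the right node. *)
Lemma le_dist_nodes i : (i <= j)%N ->
  (`|\int[mu]_(t in `[x 0, x i]) F t - \sum_(k < i) h * (F (x k) + F (x k.+1))|%:E
   <= \sum_(k < i) (\int[mu]_(s in `[0%R, h]) `|F (x k + s)%R - F (x k)|%:E +
        \int[mu]_(s in `[0%R, h]) `|F (x k.+1 - s)%R - F (x k.+1)|%:E))%E.
Proof.
elim: i => [|i IH] ij.
  by rewrite !big_ord0 set_itv1 Rintegral_set1 subrr normr0.
rewrite !big_ord_recr/=.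
have m0 : x 0 <= x i by apply: node_monotone; rewrite (ltnW ij).
have m1 : x i.+1 <= 1 by apply: le_trans xj1; apply: node_monotone; rewrite ij leqnn.
have := xS ij => e; have [hh xx0 xx1] := And3 h0 x00 xj1.
rewrite (@Rintegral_itv_split _ _ (x 0) (x i))//; [|lra|]; last first.
  exact: integrable_subitv Fi.
rewrite (@Rintegral_itv_split _ _ (x i) (x i + h))//; [|lra|lra|]; last first.
  by apply: integrable_subitv Fi => //; lra.
set A := Rintegral _ _ _; set B := Rintegral _ _ _; set C := Rintegral _ _ _.
set S := \sum_(_ < _) _.
have := @le_dist_shift (x i) (x i + h) (F (x i)) (x i).
rewrite -/B subrr (addrC (x i) h) addrK => hB.
have := @le_dist_reflect (x i + h) (x i.+1) (F (x i.+1)) (x i.+1).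
rewrite -/C subrr => hC.
have -> : A + (B + C) - (S + h * (F (x i) + F (x i.+1))) =
  (A - S) + ((B - h * F (x i)) + (C - h * F (x i.+1))) by lra.
apply: (@le_trans _ _ (`|A - S|%:E +
  (`|B - h * F (x i)|%:E + `|C - h * F (x i.+1)|%:E))%E).
  by rewrite -!EFinD lee_fin (le_trans (ler_normD _ _))// lerD2l ler_normD.
apply: leeD; first by apply: IH; exact: ltnW.
apply: leeD; first by apply: hB; lra.
have -> : h = x i.+1 - (x i + h) by lra.
by apply: hC; lra.
Qed.

(** The interval is cut at [x 0], [x j] and [x j + l]. In the coordinate [s = t - (1 - M)] the last
    piece is [[x 0, M]], so it continues the first piece, where [s = x 0 - t] runs through
    [[0, x 0]], to one integral over [[0, M]]. This domain stays fixed when [x 0] becomes random. *)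
Lemma le_dist_quadrature M l : 0 <= l -> x 0 <= M -> x j + l + M = 1 + x 0 ->
  (`|\int[mu]_(t in `[0, 1]) F t -
     (x 0 * F (x 0) + \sum_(k < j) h * (F (x k) + F (x k.+1)) +
      (1 - x j) * F (x j))|%:E <=
   \int[mu]_(s in `[0%R, M]) `|F (if (s <= x 0)%R then x 0 - s else 1 - M + s)%R -
                             F (if (s <= x 0)%R then x 0 else x j)|%:E +
   \int[mu]_(s in `[0%R, l]) `|F (x j + s)%R - F (x j)|%:E +
   \sum_(k < j) (\int[mu]_(s in `[0%R, h]) `|F (x k + s)%R - F (x k)|%:E +
        \int[mu]_(s in `[0%R, h]) `|F (x k.+1 - s)%R - F (x k.+1)|%:E))%E.
Proof.
move=> l0 xM e; have [hh xx0 xx1] := And3 h0 x00 xj1.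
have m0 : x 0 <= x j by apply: node_monotone; rewrite leqnn.
rewrite (@Rintegral_itv_split _ _ 0 (x 0))//; [|lra].
rewrite (@Rintegral_itv_split _ _ (x 0) (x j))//; last first.
  exact: integrable_subitv Fi.
rewrite (@Rintegral_itv_split _ _ (x j) (x j + l))//; [|lra|lra|]; last first.
  by apply: integrable_subitv Fi => //; lra.
set A := Rintegral _ _ _; set B := Rintegral _ _ _; set C := Rintegral _ _ _.
set D := Rintegral _ _ _; set S := \sum_(_ < _) _.
have hA := @le_dist_reflect 0 (x 0) (F (x 0)) (x 0) (lexx _) x00.
rewrite -/A subrr subr0 in hA.
have hC := @le_dist_shift (x j) (x j + l) (F (x j)) (x j).
rewrite -/C subrr (addrC (x j) l) addrK in hC.
have hD := @le_dist_shift (x j + l) 1 (F (x j)) (1 - M).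
rewrite -/D in hD.
have q1 : 1 - (1 - M) = M by lra.
have q2 : x j + l - (1 - M) = x 0 by lra.
rewrite q1 q2 in hD.
have -> : A + (B + (C + D)) - (x 0 * F (x 0) + S + (1 - x j) * F (x j)) =
  ((A - x 0 * F (x 0)) + (D - (1 - (x j + l)) * F (x j))) +
  (C - l * F (x j)) + (B - S) by lra.
apply: (@le_trans _ _ ((`|A - x 0 * F (x 0)|%:E + `|D - (1 - (x j + l)) * F (x j)|%:E)
  + `|C - l * F (x j)|%:E + `|B - S|%:E)%E).
  by rewrite -!EFinD lee_fin !(le_trans (ler_normD _ _))// !lerD// ?ler_normD//
     (le_trans (ler_normD _ _))// lerD2r ler_normD.
apply: leeD; last exact: le_dist_nodes.
apply: leeD; last by apply: hC; lra.
rewrite (@itv_bndbnd_setU _ _ (BLeft 0) (BRight (x 0)))/= ?bnd_simp//.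
set G := fun s => `| _ |%:E.
have mG : measurable_fun setT G.
  apply/measurable_EFinP; apply: measurableT_comp => //.
  apply: measurable_funB; apply: measurableT_comp => //; apply: measurable_fun_ifT => //.
  - exact: measurable_fun_ler.
  - exact: measurable_funB.
  - exact: measurable_funD.
  - exact: measurable_fun_ler.
rewrite ge0_integral_setU//=; last 2 first.
- exact: measurable_funTS.
- apply/disj_setPS => y [/=]; rewrite 2!in_itv/= => /andP[_ yx] /andP[].
  by rewrite ltNge yx.
apply: leeD.
  rewrite (_ : integral _ _ G = (\int[mu]_(s in `[0%R, x 0])
    `|F (x 0 - s)%R - F (x 0)|%:E)%E).
    by apply: hA; lra.
  by apply: eq_integral => s; rewrite inE/= in_itv/= /G => /andP[_ ->].
rewrite (_ : integral _ _ G = (\int[mu]_(s in `]x 0, M])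
    `|F (1 - M + s)%R - F (x j)|%:E)%E).
  rewrite integral_itv_obnd_cbnd; first by apply: hD; lra.
  apply/measurable_EFinP; apply: measurableT_comp => //.
  apply: measurable_funB => //; apply: measurable_funTS.
  by apply: measurableT_comp => //; exact: measurable_funD.
by apply: eq_integral => s; rewrite inE/= in_itv/= /G ltNge => /andP[/negbTE -> _].
Qed.

End quadrature.

(** * Truncation of times to the unit interval *)

Section clip.
Context {R : realType}.
Implicit Types x y : R.

(** Measurability of a process is given only for times in [[0, 1]]; composition with [clip] yields
    paths measurable on the whole line and unchanged on [[0, 1]]. The formula is that of
    [shift_fun], so truncated shifts are values of [clip]. *)
Definition clip x : R := Num.max 0 (Num.min 1 x).

Lemma clip_itv x : 0 <= clip x <= 1.
Proof. by rewrite /clip le_max lexx /= ge_max ler01 ge_min lexx. Qed.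

Lemma clip_id x : 0 <= x <= 1 -> clip x = x.
Proof. by move=> /andP[x0 x1]; rewrite /clip min_r// max_r. Qed.

Lemma clip_dist x y : `|clip x - clip y| <= `|x - y|.
Proof.
wlog xy : x y / x <= y => [H|].
  have [|/ltW yx] := leP x y; first exact: H.
  by rewrite distrC (distrC x); exact: H.
rewrite distrC (distrC x) !ger0_norm ?subr_ge0//.
  by rewrite /clip /Num.max /Num.min; repeat case: ifPn; rewrite -?leNgt => *; lra.
by rewrite /clip /Num.max /Num.min; repeat case: ifPn; rewrite -?leNgt => *; lra.
Qed.

Lemma measurable_clip : measurable_fun setT clip.
Proof.
by apply: measurable_maxr => //; apply: measurable_minr => //.
Qed.

End clip.

(** * Random times and averages of a process over them *)

Section process.
Context {R : realType} {d : measure_display} {T : measurableType d}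
        (P : probability T R).
Notation mu := (@lebesgue_measure R).
Implicit Types (xi : process P) (tau theta : random_time P).

Section clip_time.
Variables (f : T -> R) (mf : measurable_fun setT f).

Definition clip_fun (x : T) : R := clip (f x).

Lemma measurable_clip_fun : measurable_fun setT clip_fun.
Proof. exact: measurableT_comp measurable_clip mf. Qed.

HB.instance Definition _ :=
  isMeasurableFun.Build _ _ _ _ clip_fun measurable_clip_fun.

Definition clip_time : random_time P :=
  @RandomTime _ _ _ P clip_fun (fun x => clip_itv (f x)).

End clip_time.

Lemma measurable_process_comp xi d' (U : measurableType d')
    (g : U -> R) (h : U -> T) :
  measurable_fun setT g -> (forall u, 0 <= g u <= 1) -> measurable_fun setT h ->
  measurable_fun setT (fun u => xi (g u) (h u)).
Proof.
move=> mg g01 mh.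
apply: (@measurable_comp _ _ _ _ _ _ ((`[0, 1]%classic : set R) `*` [set: T])
  (fun p : R * T => xi p.1 p.2) setT (fun u => (g u, h u))).
- by apply: measurableX => //; exact: measurable_itv.
- by move=> _ [u _ <-]; split => //=; rewrite in_itv /=; exact: g01.
- exact: process_meas.
- exact: measurable_fun_pair.
Qed.

Variables (w : R -> R) (hw : concave_modulus w).

(** The lower bound is included because [w] is monotone only on nonnegative arguments. Both bounds
    together make the essential supremum finite, so that [fine] keeps its value. *)
Lemma linfty_norm_le (eta : T -> R) c : 0 <= c -> {ae P, forall x, `|eta x| <= c} ->
  0 <= linfty_norm P eta <= c.
Proof.
move=> c0 h; rewrite /linfty_norm.
have l0 : (0 <= ess_sup P (fun x => `|eta x|%:E))%E.
  apply: ess_sup_ger; first by rewrite [ltRHS](@probability_setT _ _ _ P) lte01.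
  by move=> t; rewrite lee_fin.
have lc : (ess_sup P (fun x => `|eta x|%:E) <= c%:E)%E.
  by apply/ess_supP; apply: filterS h => x; rewrite lee_fin.
by rewrite fine_ge0//= -lee_fin fineK// ge0_fin_numE// (le_lt_trans lc)// ltry.
Qed.

Lemma process_class_le xi tau theta c : process_class w xi -> 0 <= c ->
  {ae P, forall x, `|tau x - theta x| <= c} ->
  (\int[P]_x `|xi (tau x) x - xi (theta x) x|%:E <= (w c)%:E)%E.
Proof.
move=> cxi c0 h; have /andP[n0 nc] := linfty_norm_le c0 h.
have := cxi tau theta; rewrite unlock => /le_trans; apply.
by rewrite lee_fin; exact: (modulus_ndecr hw).
Qed.

Section tonelli.
Variables (xi : process P) (cxi : process_class w xi).
Variables (T1 T2 : R * T -> R).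
Hypotheses (mT1 : measurable_fun setT T1) (mT2 : measurable_fun setT T2).
Hypotheses (T1i : forall p, 0 <= T1 p <= 1) (T2i : forall p, 0 <= T2 p <= 1).
Variable r : R.

(** The domain is absorbed into the integrand by restriction, so that Tonelli applies on the whole
    product space. *)
Let D : set (R * T) := (`[0, r]%classic : set R) `*` setT.
Let f : R * T -> \bar R :=
  fun p => `|xi (T1 p) p.2 - xi (T2 p) p.2|%:E.

Let mf : measurable_fun setT f.
Proof.
apply/measurable_EFinP; apply: measurableT_comp => //.
by apply: measurable_funB; apply: measurable_process_comp => //.
Qed.

Let mD : measurable D.
Proof. by apply: measurableX => //; exact: measurable_itv. Qed.

Let mfD : measurable_fun setT (f \_ D).
Proof. by apply: (measurable_restrictT _ _).1 => //; exact: measurable_funTS. Qed.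

Let fD0 p : (0 <= (f \_ D) p)%E.
Proof. by apply: erestrict_ge0 => q _; rewrite lee_fin. Qed.

Let fDE x : (\int[mu]_(s in `[0%R, r]) f (s, x) = \int[mu]_s (f \_ D) (s, x))%E.
Proof.
rewrite integral_mkcond; apply: eq_integral => s _.
have [sr|sr] := boolP (s \in (`[0, r]%classic : set R)).
  by rewrite !patchT// inE; split => //; exact: set_mem.
rewrite !patchN//; apply/negP; rewrite inE => -[/= s0r _].
by move/negP: sr; apply; rewrite inE.
Qed.

Lemma measurable_time_average :
  measurable_fun setT (fun x => \int[mu]_(s in `[0%R, r])
    `|xi (T1 (s, x)) x - xi (T2 (s, x)) x|%:E)%E.
Proof.
under eq_fun do rewrite (fDE _).
exact: (measurable_fun_fubini_tonelli_G (m1 := mu)).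
Qed.

(** Tonelli moves the expectation inside. For fixed [s] the sections of [T1] and [T2] are random
    times at distance at most [s], so the class bounds the inner expectation by [w s], which is then
    integrated over [[0, r]]. *)
Lemma time_average_le :
  (forall s, 0 <= s <= r -> {ae P, forall x, `|T1 (s, x) - T2 (s, x)| <= s}) ->
  (\int[P]_x \int[mu]_(s in `[0%R, r])
    `|xi (T1 (s, x)) x - xi (T2 (s, x)) x|%:E <= (primitive_modulus w r)%:E)%E.
Proof.
move=> h; rewrite (eq_integral _ _ (fun x _ => fDE x)).
rewrite -(fubini_tonelli (m1 := mu) (m2 := P))// EFin_primitive_modulus//.
rewrite [leRHS]integral_mkcond; apply: ge0_le_integral => //.
- by move=> s _; exact: integral_ge0.
- exact: (measurable_fun_fubini_tonelli_F (m2 := P)).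
- apply: (measurable_restrictT _ _).1 => //; apply: measurable_funTS.
  by apply/measurable_EFinP; exact: measurable_modulus_ext.
move=> s _; have [sr|sr] := boolP (s \in (`[0, r]%classic : set R)).
  have s01 : 0 <= s <= r by move: sr; rewrite inE/= in_itv.
  have [s0 _] := andP s01; rewrite [leRHS]patchT//.
  have mT1s : measurable_fun setT (fun x => T1 (s, x)) by exact: measurableT_comp.
  have mT2s : measurable_fun setT (fun x => T2 (s, x)) by exact: measurableT_comp.
  have := @process_class_le xi (clip_time mT1s) (clip_time mT2s) s cxi s0.
  rewrite modulus_extE//= => H; apply: le_trans (H _).
    rewrite le_eqVlt; apply/orP; left; apply/eqP; apply: eq_integral => x _.
    by rewrite /clip_fun !clip_id// patchT// inE; split => //=; rewrite in_itv.
  by apply: filterS (h s s01) => x; rewrite /clip_fun !clip_id.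
rewrite [leRHS]patchN// /fubini_F integral0_eq// => x _; rewrite patchN//.
by apply/negP; rewrite inE => -[/= s0r _]; move/negP: sr; apply; rewrite inE.
Qed.

End tonelli.

End process.

(** * The quadrature error in expectation *)

Section upper_bound.
Context {R : realType} {d : measure_display} {T : measurableType d}
        (P : probability T R).
Notation mu := (@lebesgue_measure R).
Implicit Types (xi : process P).

Lemma measurable_path xi x : measurable_fun setT (fun t => xi (clip t) x).
Proof.
apply: measurable_process_comp => //; first exact: measurable_clip.
by move=> u; exact: clip_itv.
Qed.

(** The integral must be measurable also at outcomes whose path is not integrable, so Tonelli is
    applied to the positive and negative parts separately. *)
Lemma measurable_process_integral xi :
  measurable_fun setT (fun x => \int[mu]_(t in `[0, 1]) xi t x).
Proof.
pose D : set (R * T) := (`[0, 1]%classic : set R) `*` setT.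
pose f : R * T -> \bar R := fun p => (xi (clip p.1) p.2)%:E.
have mD : measurable D by apply: measurableX => //; exact: measurable_itv.
have mf : measurable_fun setT f.
  apply/measurable_EFinP; apply: measurable_process_comp => //.
    by apply: measurableT_comp => //; exact: measurable_clip.
  by move=> u; exact: clip_itv.
have mfD : measurable_fun setT (f \_ D).
  by apply: (measurable_restrictT _ _).1 => //; exact: measurable_funTS.
have fE x : (\int[mu]_(t in `[0%R, 1%R]) (xi t x)%:E =
    \int[mu]_t ((f \_ D)^\+ (t, x)) - \int[mu]_t ((f \_ D)^\- (t, x)))%E.
  rewrite integral_mkcond integralE; congr (_ - _)%E; apply: eq_integral => t _;
    rewrite ?funeposE ?funenegE /f.
  - have [sr|sr] := boolP (t \in (`[0, 1]%classic : set R)).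
      rewrite !patchT// ?inE/=; last by split => //; exact: set_mem.
      by rewrite clip_id//; move: sr; rewrite inE/= in_itv.
    rewrite !patchN//; apply/negP; rewrite inE => -[/= s0r _].
    by move/negP: sr; apply; rewrite inE.
  - have [sr|sr] := boolP (t \in (`[0, 1]%classic : set R)).
      rewrite !patchT// ?inE/=; last by split => //; exact: set_mem.
      by rewrite clip_id//; move: sr; rewrite inE/= in_itv.
    rewrite !patchN//; apply/negP; rewrite inE => -[/= s0r _].
    by move/negP: sr; apply; rewrite inE.
apply: measurableT_comp => //; rewrite (eq_fun fE); apply: emeasurable_funB.
- apply: (measurable_fun_fubini_tonelli_G (m1 := mu)) => //.
  exact: measurable_funepos.
- apply: (measurable_fun_fubini_tonelli_G (m1 := mu)) => //.
  exact: measurable_funeneg.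
Qed.

Variables (w : R -> R) (hw : concave_modulus w).
Local Notation I := (primitive_modulus w).

(** Comparison with the time 0: the integral of [|xi_t - xi_0|] over [[0, 1]] has expectation at
    most [I 1], hence is finite almost everywhere, and the constant [xi_0] can be added back. *)
Lemma integrable_path xi : process_class w xi ->
  {ae P, forall x, mu.-integrable `[0, 1] (EFin \o (fun t => xi (clip t) x))}.
Proof.
move=> cxi.
pose T1 (p : R * T) : R := clip p.1; pose T2 (p : R * T) : R := clip 0.
have mT1 : measurable_fun setT T1.
  by apply: measurableT_comp => //; exact: measurable_clip.
have T1i p : 0 <= T1 p <= 1 by exact: clip_itv.
have T2i p : 0 <= T2 p <= 1 by exact: clip_itv.
have mT2 : measurable_fun setT T2 by exact: measurable_cst.
have ms := measurable_time_average xi mT1 mT2 T1i T2i 1.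
have lt : (\int[P]_x \int[mu]_(s in `[0%R, 1%R])
    `|xi (T1 (s, x)) x - xi (T2 (s, x)) x|%:E < +oo)%E.
  apply: le_lt_trans (ltry (I 1)); apply: time_average_le => // s /andP[s0 _].
  apply: aeW => x /=; apply: le_trans (clip_dist _ _) _.
  by rewrite subr0 ger0_norm.
have : P.-integrable setT (fun x => \int[mu]_(s in `[0%R, 1%R])
    `|xi (T1 (s, x)) x - xi (T2 (s, x)) x|%:E)%E.
  apply/integrableP; split => //.
  rewrite (eq_integral (fun x => \int[mu]_(s in `[0%R, 1%R])
    `|xi (T1 (s, x)) x - xi (T2 (s, x)) x|%:E)%E)// => x _.
  by rewrite gee0_abs//; exact: integral_ge0.
move/(integrable_ae measurableT); apply: filterS => x /(_ Logic.I) fx.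
have gi : mu.-integrable `[0, 1] (EFin \o (fun t => xi (clip t) x - xi (clip 0) x)).
  apply/integrableP; split.
    apply/measurable_EFinP; apply: measurable_funTS; apply: measurable_funB => //.
    exact: measurable_path.
  by rewrite -ge0_fin_numE//; exact: integral_ge0.
have := integrableD _ gi (integrable_cst_itv 0 1 (xi (clip 0) x)).
move=> /(_ ltac:(by [])); apply: eq_integrable => // t _ /=.
by rewrite -EFinD subrK.
Qed.

Section quadrature_error.
Variables (xi : process P) (y : nat -> random_time P) (h : R) (j : nat).
Hypothesis cxi : process_class w xi.

Definition quadrature (X : nat -> T -> R) (x : T) : R :=
  y 0%N x * X 0%N x + \sum_(k < j) h * (X k x + X k.+1 x) + (1 - y j x) * X j x.

Lemma measurable_quadrature (X : nat -> T -> R) :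
  (forall k, measurable_fun setT (X k)) -> measurable_fun setT (quadrature X).
Proof.
move=> mX; apply: measurable_funD; [apply: measurable_funD|].
- exact: measurable_funM.
- apply: measurable_sum => k; apply: measurable_funM => //.
  exact: measurable_funD.
- by apply: measurable_funM => //; exact: measurable_funB.
Qed.

(* The part of [[y j + l, 1]] left over when [y 0 < M] is matched with the part
   of [[0, M]] missing to the left of the first node: the point at distance
   [s - (y 0 - l)] to the right of [y j] is compared at scale [s > y 0]. This
   costs nothing, since [l <= y 0]. *)
Lemma quadrature_error_le M l : 0 <= h -> 0 <= l -> 0 <= M ->
  l + M + 2 * j%:R * h = 1 ->
  {ae P, forall x, forall k, (k < j)%N -> y k.+1 x = y k x + 2 * h} ->
  {ae P, forall x, l <= y 0%N x <= M} ->
  ('E_P[fun x => `|\int[mu]_(t in `[0, 1]) xi t x -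
     quadrature (fun k => sample_fun xi (y k)) x|%R] <=
   (I M + I l + \sum_(k < j) (I h + I h))%:E)%E.
Proof.
move=> h0 l0 M0 e aeS aeM.
(* The pairs of times to compare: [S1], [S2] on the left end piece joined with the surplus of the
   right one, [L1], [L2] to the right of a node, [Q1], [L2] to the left. Truncation puts them in
   [[0, 1]] for every [p] and can only shorten distances. *)
pose S1 (p : R * T) : R :=
  clip (if p.1 <= y 0%N p.2 then y 0%N p.2 - p.1 else 1 - M + p.1).
pose S2 (p : R * T) : R := clip (if p.1 <= y 0%N p.2 then y 0%N p.2 else y j p.2).
pose L1 k (p : R * T) : R := clip (y k p.2 + p.1).
pose L2 k (p : R * T) : R := clip (y k p.2).
pose Q1 k (p : R * T) : R := clip (y k p.2 - p.1).
have my k : measurable_fun [set: R * T] (fun p => y k p.2) by exact: measurableT_comp.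
have m1 : measurable_fun [set: R * T] (fun p => p.1) by exact: measurable_fst.
have mS1 : measurable_fun setT S1.
  apply: measurableT_comp; first exact: measurable_clip.
  apply: measurable_fun_ifT; first exact: measurable_fun_ler.
  - exact: measurable_funB.
  - exact: measurable_funD.
have mS2 : measurable_fun setT S2.
  apply: measurableT_comp; first exact: measurable_clip.
  by apply: measurable_fun_ifT => //; exact: measurable_fun_ler.
have mL1 k : measurable_fun setT (L1 k).
  apply: measurableT_comp; first exact: measurable_clip.
  exact: measurable_funD.
have mL2 k : measurable_fun setT (L2 k).
  by apply: measurableT_comp; first exact: measurable_clip.
have mQ1 k : measurable_fun setT (Q1 k).
  apply: measurableT_comp; first exact: measurable_clip.
  exact: measurable_funB.
have iS1 p : 0 <= S1 p <= 1 by exact: clip_itv.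
have iS2 p : 0 <= S2 p <= 1 by exact: clip_itv.
have iL1 k p : 0 <= L1 k p <= 1 by exact: clip_itv.
have iL2 k p : 0 <= L2 k p <= 1 by exact: clip_itv.
have iQ1 k p : 0 <= Q1 k p <= 1 by exact: clip_itv.
pose avg r (A B : R * T -> R) x :=
  (\int[mu]_(s in `[0%R, r]) `|xi (A (s, x)) x - xi (B (s, x)) x|%:E)%E : \bar R.
have avg0 r A B x : (0 <= avg r A B x)%E by exact: integral_ge0.
have mavg r (A B : R * T -> R) (mA : measurable_fun setT A) (mB : measurable_fun setT B)
    (iA : forall p, 0 <= A p <= 1) (iB : forall p, 0 <= B p <= 1) :
    measurable_fun setT (avg r A B) by exact: measurable_time_average.
have aeE : {ae P, forall x, forall k, (k <= j)%N -> y k x = y 0%N x + 2 * k%:R * h}.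
  apply: filterS aeS => x xS; elim => [|k IH] kj.
    by rewrite mulr0 mul0r addr0.
  by rewrite xS// IH ?(ltnW kj)// -natr1; lra.
have -> : (I M + I l + \sum_(k < j) (I h + I h))%:E =
    ((I M)%:E + (I l)%:E + \sum_(k < j) ((I h)%:E + (I h)%:E))%E.
  by rewrite !EFinD -sumEFin.
rewrite unlock.
apply: (@le_trans _ _ (\int[P]_x (avg M S1 S2 x + avg l (L1 j) (L2 j) x +
  \sum_(k < j) (avg h (L1 k) (L2 k) x + avg h (Q1 k.+1) (L2 k.+1) x)))%E).
  apply: ae_ge0_le_integral => //.
  - apply/measurable_EFinP; apply: measurableT_comp => //; apply: measurable_funB.
      exact: measurable_process_integral.
    by apply: measurable_quadrature => k; exact: measurable_sample.
  - move=> x _; apply: adde_ge0; first exact: adde_ge0.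
    by apply: sume_ge0 => k _; exact: adde_ge0.
  - apply: emeasurable_funD; first by apply: emeasurable_funD; exact: mavg.
    apply: emeasurable_sum => k; apply: emeasurable_funD; exact: mavg.
  apply: filterS3 (integrable_path cxi) aeS (filterI aeM aeE) =>
    x xi_i xS [/andP[ly yM] xE] _.
  have yi k : 0 <= y k x <= 1 by exact: time_itv.
  (* The pathwise estimate; its condition [x j + l + M = 1 + x 0] follows from [e] and the position
     of the last node given by [xE]. *)
  have := @le_dist_quadrature R _ (measurable_path xi x) xi_i (fun k => y k x) h j
    h0 xS (proj1 (andP (yi 0%N))) (proj2 (andP (yi j))) M l l0 yM.
  move=> H; have {}H := H ltac:(rewrite (xE j)//; lra).
  apply: (le_trans _ H); rewrite le_eqVlt; apply/orP; left; apply/eqP.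
  congr (`| _ - _ |%:E).
    by apply: eq_Rintegral => t; rewrite inE/= in_itv/= => ?; rewrite clip_id.
  rewrite /quadrature /sample_fun; congr (_ + _ + _).
  + by rewrite clip_id.
  + by apply: eq_bigr => k _; rewrite !clip_id.
  + by rewrite clip_id.
have mterm k : measurable_fun setT (fun x =>
    avg h (L1 k) (L2 k) x + avg h (Q1 k.+1) (L2 k.+1) x)%E.
  by apply: emeasurable_funD; exact: mavg.
rewrite ge0_integralD//; last 4 first.
- by move=> x _; exact: adde_ge0.
- by apply: emeasurable_funD; exact: mavg.
- by move=> x _; apply: sume_ge0 => k _; exact: adde_ge0.
- exact: emeasurable_sum.
rewrite ge0_integralD//; last 2 first.
- exact: mavg.
- exact: mavg.
rewrite ge0_integral_sum//; last by move=> k x _; exact: adde_ge0.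
have clipB a b c : `|a - b| <= c -> `|clip a - clip b| <= c.
  exact: le_trans (clip_dist _ _).
apply: leeD; first apply: leeD.
- apply: time_average_le => // s /andP[s0 sM].
  apply: filterS2 aeM aeE => x /andP[ly yM] xE; apply: clipB => /=.
  case: ifPn; rewrite -?ltNge => sy.
    by rewrite ler_norml; apply/andP; split; lra.
  by rewrite xE// ler_norml; apply/andP; split; lra.
- apply: time_average_le => // s /andP[s0 sl].
  by apply: aeW => x; apply: clipB => /=; rewrite ler_norml; apply/andP; split; lra.
- apply: lee_sum => k _; rewrite ge0_integralD//; last 2 first.
  - exact: mavg.
  - exact: mavg.
  apply: leeD; apply: time_average_le => // s /andP[s0 sl].
  + by apply: aeW => x; apply: clipB => /=; rewrite ler_norml; apply/andP; split; lra.
  + by apply: aeW => x; apply: clipB => /=; rewrite ler_norml; apply/andP; split; lra.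
Qed.

End quadrature_error.

End upper_bound.

(** * Recovery by the quadrature, and reversal of time *)

Section recovery.
Context {R : realType} {d : measure_display} {T : measurableType d}
        (P : probability T R).
Notation mu := (@lebesgue_measure R).
Implicit Types (xi : process P) (y : nat -> random_time P).

Section quadrature_rv.
Variables (y : nat -> random_time P) (h : R) (j : nat) (X : nat -> {RV P >-> R}).

Definition quadrature_rv_fun : T -> R := quadrature y h j X.

Lemma measurable_quadrature_rv_fun : measurable_fun setT quadrature_rv_fun.
Proof. exact: measurable_quadrature. Qed.

HB.instance Definition _ :=
  isMeasurableFun.Build _ _ _ _ quadrature_rv_fun measurable_quadrature_rv_fun.

Definition quadrature_rv : {RV P >-> R} := quadrature_rv_fun.

End quadrature_rv.

(** Paths have no fixed sign and are reflected at every outcome, integrable or not; the two parts of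
    [g] are therefore treated separately. *)
Lemma integral_reflect_itv (g : R -> \bar R) c a b : measurable_fun setT g ->
  (\int[mu]_(x in `[a, b]) g (c - x)%R = \int[mu]_(x in `[(c - b)%R, (c - a)%R]) g x)%E.
Proof.
move=> mg; rewrite integralE [RHS]integralE; congr (_ - _)%E.
  rewrite -(@ge0_integral_reflect_itv R g^\+%E)//; last exact: measurable_funepos.
  by apply: eq_integral => x _; rewrite !funeposE.
rewrite -(@ge0_integral_reflect_itv R g^\-%E)//; last exact: measurable_funeneg.
by apply: eq_integral => x _; rewrite !funenegE.
Qed.

Section reflection.
Variable xi : process P.

Definition reflect_fun (t : R) (x : T) : R := xi (1 - t) x.

Lemma measurable_reflect_fun :
  measurable_fun ((`[0, 1]%classic : set R) `*` [set: T])
    (fun p : R * T => reflect_fun p.1 p.2).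
Proof.
apply: (@measurable_comp _ _ _ _ _ _ ((`[0, 1]%classic : set R) `*` [set: T])
  (fun p : R * T => xi p.1 p.2) ((`[0, 1]%classic : set R) `*` [set: T])
  (fun p : R * T => (1 - p.1, p.2))).
- by apply: measurableX => //; exact: measurable_itv.
- move=> _ [[t x] [/= t01 _] <-]; split => //=.
  by move: t01; rewrite !in_itv/= => /andP[? ?]; apply/andP; split; lra.
- exact: process_meas.
- apply: measurable_funTS; apply: measurable_fun_pair => //.
  exact: measurable_funB.
Qed.

Definition reflect : process P := @Process _ _ _ P _ measurable_reflect_fun.

End reflection.

Section reflect_time.
Variable tau : random_time P.

Definition reflect_time_fun (x : T) : R := 1 - tau x.

Lemma measurable_reflect_time_fun : measurable_fun setT reflect_time_fun.
Proof. exact: measurable_funB. Qed.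

HB.instance Definition _ :=
  isMeasurableFun.Build _ _ _ _ reflect_time_fun measurable_reflect_time_fun.

Lemma reflect_time_itv x : 0 <= reflect_time_fun x <= 1.
Proof.
by have /andP[? ?] := time_itv tau x; rewrite /reflect_time_fun; apply/andP; split; lra.
Qed.

Definition reflect_time : random_time P :=
  @RandomTime _ _ _ P reflect_time_fun reflect_time_itv.

End reflect_time.

Variables (w : R -> R) (hw : concave_modulus w).
Local Notation I := (primitive_modulus w).

Lemma process_class_reflect xi : process_class w xi -> process_class w (reflect xi).
Proof.
move=> cxi tau theta; have := cxi (reflect_time tau) (reflect_time theta).
rewrite (_ : linfty_norm P (fun x => reflect_time tau x - reflect_time theta x) =
  linfty_norm P (fun x => tau x - theta x))//.
congr fine; congr ess_sup; apply/funext => x /=.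
by rewrite /reflect_time_fun distrC; congr (`| _ |%:E); lra.
Qed.

Lemma Rintegral_reflect xi x :
  \int[mu]_(t in `[0, 1]) reflect xi t x = \int[mu]_(t in `[0, 1]) xi t x.
Proof.
have E : \int[mu]_(t in `[0, 1]) xi t x = \int[mu]_(t in `[0, 1]) xi (clip t) x.
  by apply: eq_Rintegral => t; rewrite inE/= in_itv/= => ?; rewrite clip_id.
rewrite E /Rintegral; congr fine.
have := @integral_reflect_itv (fun t => (xi (clip t) x)%:E) 1 0 1.
rewrite subr0 subrr => <-; last by apply/measurable_EFinP; exact: measurable_path.
apply: eq_integral => t; rewrite inE/= in_itv/= => /andP[? ?].
by rewrite clip_id//; apply/andP; split; lra.
Qed.

(** Reversing both time and the order of the nodes swaps the two end terms and permutes the gaps. *)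
Lemma quadrature_reflect y h j (X : nat -> T -> R) x :
  quadrature (fun k => reflect_time (y (j - k)%N)) h j (fun k => X (j - k)%N) x =
  quadrature y h j X x.
Proof.
rewrite /quadrature subnn subn0 /= /reflect_time_fun.
suff -> : \sum_(k < j) h * (X (j - k)%N x + X (j - k.+1)%N x) =
    \sum_(k < j) h * (X k x + X k.+1 x) by lra.
rewrite [RHS](reindex_inj rev_ord_inj)/=; apply: eq_bigr => k _.
by rewrite (addrC (X (j - k)%N x)) -subSn// subSS.
Qed.

(** If it is the right end piece whose length lies in [[l, M]], time is reversed: the class, the
    integral and the quadrature are invariant, and the estimate for the left end piece applies to
    [reflect xi]. *)
Lemma optimal_error_le j (taus : 'I_j.+1 -> random_time P) y h M l :
  (forall k : 'I_j.+1, taus k = y k) ->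
  0 <= h -> 0 <= l -> 0 <= M -> l + M + 2 * j%:R * h = 1 ->
  {ae P, forall x, forall k, (k < j)%N -> y k.+1 x = y k x + 2 * h} ->
  {ae P, forall x, l <= y 0%N x <= M} \/ {ae P, forall x, l <= 1 - y j x <= M} ->
  (optimal_error w taus <= (I M + I l + 2 * j%:R * I h)%:E)%E.
Proof.
move=> tausE h0 l0 M0 e aeS ae_or.
(* The recovery map may use the random times [y] themselves, since they are fixed before the process
   is. *)
pose phi : recovery_map P j.+1 :=
  fun X => quadrature_rv y h j (fun k => X (inord k)).
apply: (@le_trans _ _ (recovery_error w taus phi)).
  by apply: ereal_inf_lbound; exists phi.
apply: ge_ereal_sup => _ [xi cxi <-].
have -> : I M + I l + 2 * j%:R * I h = I M + I l + \sum_(k < j) (I h + I h).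
  by rewrite sumr_const card_ord -mulr_natl; lra.
have -> : (fun x => `|\int[mu]_(t in `[0, 1]) xi t x -
     (phi (fun k => sample xi (taus k)) x : R)|) =
   (fun x => `|\int[mu]_(t in `[0, 1]) xi t x -
     quadrature y h j (fun k => sample_fun xi (y k)) x|).
  apply/funext => x; congr (`| _ - _ |).
  rewrite /phi /= /quadrature_rv_fun /quadrature.
  have tE k : (k <= j)%N -> taus (inord k) = y k by move=> kj; rewrite tausE inordK.
  rewrite !tE//; congr (_ + _ + _); apply: eq_bigr => k _.
  by rewrite !tE// ltnW.
case: ae_or => aeM; first exact: quadrature_error_le.
pose y' k := reflect_time (y (j - k)%N).
have := @quadrature_error_le _ _ _ P w hw (reflect xi) y' h j
  (process_class_reflect cxi) M l h0 l0 M0 e.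
rewrite /y' subn0 => H; apply: le_trans (H _ aeM).
  rewrite le_eqVlt; apply/orP; left; apply/eqP; congr expectation.
  apply/funext => x; rewrite Rintegral_reflect; congr (`| _ - _ |).
  rewrite -[LHS]quadrature_reflect; congr quadrature.
  apply/funext => k; apply/funext => z.
  by rewrite /sample_fun/= /reflect_fun /reflect_time_fun subKr.
apply: filterS aeS => x xS k kj /=; rewrite /reflect_time_fun.
have := xS (j - k.+1)%N ltac:(lia).
have -> : (j - k.+1).+1 = (j - k)%N by lia.
by move=> ->; lra.
Qed.

End recovery.

(** * Lower bound *)

Section near_dist.
Context {R : realType}.
Implicit Types (x : nat -> R) (c s t : R).

(** The distance from [t] to the set of nodes [x 0, ..., x j]. As an iterated minimum it is
    measurable jointly in [t] and the nodes by induction. *)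
Fixpoint near_dist x (j : nat) t : R :=
  if j is i.+1 then Num.min (near_dist x i t) `|t - x j| else `|t - x 0%N|.

Lemma near_dist_ge x j t c :
  (forall k, (k <= j)%N -> c <= `|t - x k|) -> c <= near_dist x j t.
Proof.
elim: j => [|j IH] H /=; first exact: H.
by rewrite le_min H// andbT; apply: IH => k kj; apply: H; exact: leqW.
Qed.

Lemma near_dist_ge0 x j t : 0 <= near_dist x j t.
Proof. by apply: near_dist_ge. Qed.

Lemma near_dist_le x j t k : (k <= j)%N -> near_dist x j t <= `|t - x k|.
Proof.
elim: j => [|j IH] /=; first by rewrite leqn0 => /eqP ->.
rewrite ge_min leq_eqVlt => /predU1P[->|kj]; first by rewrite lexx orbT.
by rewrite IH.
Qed.

Lemma near_dist_node x j k : (k <= j)%N -> near_dist x j (x k) = 0.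
Proof.
move=> kj; apply/eqP; rewrite eq_le near_dist_ge0 andbT.
by rewrite (le_trans (near_dist_le _ _ kj))// subrr normr0.
Qed.

Lemma near_dist_lipschitz x j s t :
  `|near_dist x j s - near_dist x j t| <= `|s - t|.
Proof.
have half a b : near_dist x j a <= near_dist x j b + `|a - b|.
  rewrite -lerBlDr; apply: near_dist_ge => k kj; rewrite lerBlDr.
  apply: (le_trans (near_dist_le _ _ kj)).
  by rewrite (_ : a - x k = (b - x k) + (a - b)) ?ler_normD//; lra.
have := half s t; have := half t s; rewrite (distrC t s) ler_norml => *.
by apply/andP; split; lra.
Qed.

Lemma measurable_near_dist d' (U : measurableType d') (a : nat -> U -> R)
    (t : U -> R) j :
  (forall k, measurable_fun setT (a k)) -> measurable_fun setT t ->
  measurable_fun setT (fun u => near_dist (fun k => a k u) j (t u)).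
Proof.
move=> ma mt; elim: j => [|j IH] /=.
  by apply: measurableT_comp => //; exact: measurable_funB.
apply: measurable_minr => //.
by apply: measurableT_comp => //; exact: measurable_funB.
Qed.

End near_dist.

(** * Integrals of the modulus of the distance to the nodes *)

Section near_dist_integral.
Context {R : realType} (w : R -> R).
Hypothesis hw : concave_modulus w.
Notation mu := (@lebesgue_measure R).
Local Notation I := (primitive_modulus w).
Local Notation v := (modulus_ext w).
Variables (x : nat -> R) (j : nat).
Local Notation nd := (near_dist x j).

Lemma integrable_itv_bounded (f : R -> R) (a b C : R) :
  measurable_fun setT f -> (forall t, a <= t <= b -> 0 <= f t <= C) ->
  mu.-integrable `[a, b] (EFin \o f).
Proof.
move=> mf fC; apply: measurable_bounded_integrable => //.
- by rewrite /= lebesgue_measure_itv/=; case: ifPn => // _; rewrite -EFinB ltry.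
- exact: measurable_funTS.
exists C; split; first exact: num_real.
move=> y Cy t /=; rewrite in_itv/= => /fC /andP[f0 fc].
by rewrite ger0_norm//; exact: le_trans fc (ltW Cy).
Qed.

Lemma integrable_near_dist a b : mu.-integrable `[a, b] (EFin \o (fun t => v (nd t))).
Proof.
apply: (@integrable_itv_bounded _ _ _ (v (Num.max `|a - x 0%N| `|b - x 0%N|))).
  apply: measurableT_comp; first exact: measurable_modulus_ext.
  by apply: measurable_near_dist => // k; exact: measurable_cst.
move=> t /andP[at0 tb]; rewrite modulus_ext_ge0//=.
apply: modulus_ext_ndecr => //; apply: le_trans (near_dist_le x t (leq0n j)) _.
have := ler_norm (b - x 0%N); have := ler_norm (- (a - x 0%N)); rewrite normrN.
move=> h1 h2; rewrite le_max; case: (leP (t - x 0%N) 0) => t0; apply/orP.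
  by left; rewrite ler0_norm//; lra.
by right; rewrite gtr0_norm//; lra.
Qed.

Lemma near_dist_integral_right a b : a <= b ->
  (forall t, a <= t <= b -> t - a <= nd t) ->
  I (b - a) <= \int[mu]_(t in `[a, b]) v (nd t).
Proof.
move=> ab H; rewrite -Rintegral_modulus_right//; apply: le_Rintegral => //.
- apply: (@integrable_itv_bounded _ _ _ (v (b - a))).
    by apply: measurableT_comp; [exact: measurable_modulus_ext|exact: measurable_funB].
  move=> t /andP[? ?]; rewrite modulus_ext_ge0//=; apply: modulus_ext_ndecr => //; lra.
- exact: integrable_near_dist.
by move=> t /=; rewrite in_itv/= => /H; exact: modulus_ext_ndecr.
Qed.

Lemma near_dist_integral_left a b : a <= b ->
  (forall t, a <= t <= b -> b - t <= nd t) ->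
  I (b - a) <= \int[mu]_(t in `[a, b]) v (nd t).
Proof.
move=> ab H; rewrite -Rintegral_modulus_left//; apply: le_Rintegral => //.
- apply: (@integrable_itv_bounded _ _ _ (v (b - a))).
    by apply: measurableT_comp; [exact: measurable_modulus_ext|exact: measurable_funB].
  move=> t /andP[? ?]; rewrite modulus_ext_ge0//=; apply: modulus_ext_ndecr => //; lra.
- exact: integrable_near_dist.
by move=> t /=; rewrite in_itv/= => /H; exact: modulus_ext_ndecr.
Qed.

Hypothesis xnd : forall i k, (i <= k <= j)%N -> x i <= x k.

(* The [i] gaps contribute [2 * I (gap / 2)] each; the tangent of [I] at an
   arbitrary [h] replaces the gaps by their sum. *)
Lemma near_dist_integral_gaps h i : 0 <= h -> (i <= j)%N ->
  (x i - x 0%N) * w h + 2 * i%:R * (I h - h * w h) <=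
  \int[mu]_(t in `[x 0%N, x i]) v (nd t).
Proof.
move=> h0; elim: i => [|i IH] ij.
  rewrite subrr mul0r mulr0 mul0r addr0.
  by apply: Rintegral_ge0 => t _; exact: modulus_ext_ge0.
have a0 : x 0%N <= x i by apply: xnd; rewrite leq0n ltnW.
have a1 : x i <= x i.+1 by apply: xnd; rewrite leqnSn ij.
set c := (x i + x i.+1) / 2.
have c0 : x i <= c by rewrite /c; lra.
have c1 : c <= x i.+1 by rewrite /c; lra.
rewrite (Rintegral_itv_split a0)//; last exact: integrable_near_dist.
rewrite (Rintegral_itv_split c0)//; last exact: integrable_near_dist.
(* No node lies strictly inside the gap, so every node is at least as far from [t] as one of the two
   ends of the gap; on each half the nearer end then bounds all distances. *)
have sep t k : x i <= t <= x i.+1 -> (k <= j)%N ->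
    t - x i <= `|t - x k| \/ x i.+1 - t <= `|t - x k|.
  move=> /andP[it ti] kj; have [ki|ik] := leqP k i; [left|right].
    by rewrite (le_trans _ (ler_norm _))//;
      have := xnd (i := k) (k := i); rewrite ki (ltnW ij) => /(_ isT); lra.
  by rewrite distrC (le_trans _ (ler_norm _))//;
    have := xnd (i := i.+1) (k := k); rewrite ik kj => /(_ isT); lra.
have r1 : I (c - x i) <= \int[mu]_(t in `[x i, c]) v (nd t).
  apply: near_dist_integral_right => // t /andP[t0 t1]; apply: near_dist_ge => k kj.
  have := sep t k _ kj; rewrite t0 (le_trans t1 c1) => /(_ isT)[//|].
  by move: t1; rewrite /c; lra.
have r2 : I (x i.+1 - c) <= \int[mu]_(t in `[c, x i.+1]) v (nd t).
  apply: near_dist_integral_left => // t /andP[t0 t1]; apply: near_dist_ge => k kj.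
  have := sep t k _ kj; rewrite t1 (le_trans c0 t0) => /(_ isT)[|//].
  by move: t0; rewrite /c; lra.
have := primitive_modulus_tangent hw h0 (y := c - x i).
have := primitive_modulus_tangent hw h0 (y := x i.+1 - c).
rewrite !subr_ge0 => /(_ c1) g2 /(_ c0) g1.
have := IH (ltnW ij).
have e1 : x i.+1 - c = (x i.+1 - x i) / 2 by rewrite /c; lra.
have e2 : c - x i = (x i.+1 - x i) / 2 by rewrite /c; lra.
rewrite e1 in r2 g2; rewrite e2 in r1 g1; rewrite -natr1.
by move: r1 r2 g1 g2; clear; lra.
Qed.

(** Beyond an end node the nearest node is that end node. The end pieces are kept as values of [I],
    because their lengths will vary with [tau]; only the gaps are linearized. *)
Lemma near_dist_integral_ge h : 0 <= h -> 0 <= x 0%N -> x j <= 1 ->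
  I (x 0%N) + ((x j - x 0%N) * w h + 2 * j%:R * (I h - h * w h)) + I (1 - x j) <=
  \int[mu]_(t in `[0, 1]) v (nd t).
Proof.
move=> h0 x0 x1.
have a0 : x 0%N <= x j by apply: xnd; rewrite leqnn.
have ni := integrable_near_dist.
rewrite (@Rintegral_itv_split _ _ 0 (x 0%N))//; [|lra].
rewrite (@Rintegral_itv_split _ _ (x 0%N) (x j))//.
have := near_dist_integral_gaps h0 (leqnn j).
have r1 : I (x 0%N) <= \int[mu]_(t in `[0, x 0%N]) v (nd t).
  rewrite -{1}(subr0 (x 0%N)); apply: near_dist_integral_left => // t /andP[t0 t1].
  apply: near_dist_ge => k kj; rewrite distrC (le_trans _ (ler_norm _))//.
  by have := xnd (i := 0) (k := k); rewrite kj => /(_ isT); lra.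
have r2 : I (1 - x j) <= \int[mu]_(t in `[x j, 1]) v (nd t).
  apply: near_dist_integral_right => // t /andP[t0 t1].
  apply: near_dist_ge => k kj; rewrite (le_trans _ (ler_norm _))//.
  by have := xnd (i := k) (k := j); rewrite kj leqnn => /(_ isT); lra.
by move: r1 r2; clear; lra.
Qed.

End near_dist_integral.

(** * The adversarial process *)

Section lower_bound.
Context {R : realType} {d : measure_display} {T : measurableType d}
        (P : probability T R).
Notation mu := (@lebesgue_measure R).
Variables (w : R -> R) (hw : concave_modulus w).
Local Notation I := (primitive_modulus w).
Local Notation v := (modulus_ext w).
Implicit Types (xi : process P) (y : nat -> random_time P).

Lemma le_linfty_norm (tau theta : random_time P) :
  {ae P, forall x, `|tau x - theta x| <= linfty_norm P (fun x => tau x - theta x)}.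
Proof.
apply: filterS (ess_sup_ge P (fun x => `|tau x - theta x|%:E)) => x.
rewrite /linfty_norm -lee_fin fineK//.
have l1 : (ess_sup P (fun x => `|tau x - theta x|%:E) <= 1%:E)%E.
  apply: ess_sup_ler => z; have := time_itv tau z; have := time_itv theta z.
  move=> /andP[? ?] /andP[? ?]; rewrite lee_fin ler_norml.
  by apply/andP; split; lra.
have l0 : (0 <= ess_sup P (fun x => `|tau x - theta x|%:E))%E.
  apply: ess_sup_ger; first by rewrite [ltRHS](@probability_setT _ _ _ P) lte01.
  by move=> t; rewrite lee_fin.
by rewrite ge0_fin_numE// (le_lt_trans l1)// ltry.
Qed.

Section adversary.
Variables (y : nat -> random_time P) (j : nat) (A : set T) (s : R).
Hypotheses (mA : measurable A) (A0 : (0 < P A)%E).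

Let p : R := fine (P A).

Let PAE : P A = p%:E.
Proof. by rewrite fineK// fin_num_measure. Qed.

Let p0 : 0 < p.
Proof. by rewrite -lte_fin -PAE. Qed.

(** The factor [\1_A x / p] has expectation 1, so that bounds in expectation do not depend on how
    small [A] is; [s] is a sign. *)
Definition dist_process_fun (t : R) (x : T) : R :=
  s * (\1_A x / p) * v (near_dist (fun k => y k x) j t).

Lemma measurable_dist_process :
  measurable_fun ((`[0, 1]%classic : set R) `*` [set: T])
    (fun q : R * T => dist_process_fun q.1 q.2).
Proof.
apply: measurable_funTS; apply: measurable_funM.
  apply: measurable_funM => //; apply: measurable_funM => //.
  by apply: measurableT_comp => //; exact: measurable_indic.
apply: measurableT_comp; first exact: measurable_modulus_ext.
by apply: measurable_near_dist => // k; exact: measurableT_comp.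
Qed.

Definition dist_process : process P := @Process _ _ _ P _ measurable_dist_process.

Lemma sample_dist_process (tau : random_time P) k : (k <= j)%N -> tau = y k ->
  forall x, sample dist_process tau x = 0.
Proof.
move=> kj -> x; rewrite /= /sample_fun/= /dist_process_fun.
by rewrite (@near_dist_node _ (fun k => y k x))// modulus_ext0// mulr0.
Qed.

Lemma integral_dist_process x : (\int[mu]_(t in `[0, 1]) dist_process t x) =
  s * (\1_A x / p) * \int[mu]_(t in `[0, 1]) v (near_dist (fun k => y k x) j t).
Proof. by rewrite -RintegralZl//; exact: integrable_near_dist. Qed.

Lemma integral_indic_scaled (K : R) : 0 <= K ->
  (\int[P]_x (\1_A x / p * K)%:E = K%:E)%E.
Proof.
move=> K0; under eq_integral do rewrite -mulrA mulrC EFinM.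
rewrite ge0_integralZl//=.
- have -> : (\int[P]_x (\1_A x)%:E = p%:E)%E.
    by rewrite integral_indic// setIT; exact: PAE.
  by rewrite -EFinM mulrAC mulVf ?gt_eqF// mul1r.
- by apply/measurable_EFinP; exact: measurable_indic.
- by rewrite lee_fin mulr_ge0// invr_ge0 ltW.
Qed.

Hypothesis s1 : `|s| = 1.

(** At each outcome the distance to the nodes is 1-Lipschitz in time and [|v a - v b| <= v |a - b|].
    Hence the increment is almost everywhere at most [\1_A / p * w L], whose expectation is
    [w L]. *)
Lemma dist_process_class : process_class w dist_process.
Proof.
move=> tau theta; rewrite unlock /sample_fun.
set L := linfty_norm _ _.
have L0 : 0 <= L.
  have := @linfty_norm_le R d T P (fun x => tau x - theta x) 1 ler01.
  case/(_ _)/andP => //; apply: aeW => x.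
  have := time_itv tau x; have := time_itv theta x.
  by move=> /andP[? ?] /andP[? ?]; rewrite ler_norml; apply/andP; split; lra.
rewrite -(@integral_indic_scaled (w L)); last exact: modulus_ge0 hw _ _.
apply: ae_ge0_le_integral => //.
- apply/measurable_EFinP; apply: measurableT_comp => //; apply: measurable_funB;
  exact: measurable_sample.
- move=> x _; rewrite lee_fin mulr_ge0//; last exact: modulus_ge0 hw _ _.
  by rewrite divr_ge0// ltW.
- apply/measurable_EFinP; apply: measurable_funM => //; exact: measurable_funM.
apply: filterS (le_linfty_norm tau theta) => x xL _.
have c0 : 0 <= \1_A x / p by rewrite divr_ge0// ltW.
rewrite lee_fin /= /dist_process_fun -mulrBr normrM normrM s1 mul1r.
rewrite [`|_ / _|]ger0_norm //.
apply: ler_wpM2l => //.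
rewrite -(modulus_extE w L0); apply: le_trans (modulus_ext_dist hw _ _) _.
apply: modulus_ext_ndecr => //; apply: le_trans xL.
exact: near_dist_lipschitz.
Qed.

End adversary.

(** The signs [s = 1] and [s = -1] lead to the same recovery [S], while their integrals are [X] and
    [-X] with [|X - S| + |-X - S| >= 2 * X]. So twice the error is at least the expectation of
    [\1_A / p * (K + K)]. *)
Lemma optimal_error_ge_on j (taus : 'I_j.+1 -> random_time P) y (A : set T) K :
  (forall k : 'I_j.+1, taus k = y k) -> measurable A -> (0 < P A)%E ->
  {ae P, forall x, A x ->
     K <= \int[mu]_(t in `[0, 1]) v (near_dist (fun k => y k x) j t)} ->
  (K%:E <= optimal_error w taus)%E.
Proof.
move=> tausE mA A0 aeK; apply: le_ereal_inf_tmp => _ [phi _ <-].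
pose xi s := dist_process y j s mA.
have e_ge s : `|s| = 1 -> ('E_P[fun x => `|\int[mu]_(t in `[0, 1]) xi s t x -
   (phi (fun k => sample (xi s) (taus k)) x : R)|%R] <= recovery_error w taus phi)%E.
  by move=> s1; apply: ereal_sup_ubound; exists (xi s) => //; exact: dist_process_class.
have [K0|K0] := leP K 0.
  apply: le_trans (e_ge 1 (normr1 _)); apply: (@le_trans _ _ 0%E) => //.
  by rewrite unlock; exact: integral_ge0.
have N1 : `|-1 : R| = 1 by rewrite normrN1.
(* [phi] is an arbitrary map, so the samples must agree as random variables at every outcome; they
   vanish identically. *)
have zs s : (fun k => sample (xi s) (taus k)) = (fun k => sample (xi 1) (taus k)).
  apply/funext => k; apply/mfuneqP => x.
  by rewrite !(@sample_dist_process _ _ _ _ _ _ (k : nat)) ?tausE// -ltnS.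
have := e_ge 1 (normr1 _); have := e_ge (-1) N1.
rewrite (zs (-1)); set S := phi _; set e := recovery_error _ _ _ => h1 h2.
have hsum : ((K + K)%:E <= e + e)%E.
  apply: le_trans (leeD h1 h2); rewrite unlock -ge0_integralD//; last 2 first.
  - apply/measurable_EFinP; apply: measurableT_comp => //; apply: measurable_funB => //.
    exact: measurable_process_integral.
  - apply/measurable_EFinP; apply: measurableT_comp => //; apply: measurable_funB => //.
    exact: measurable_process_integral.
  rewrite -(integral_indic_scaled mA A0 (ltW (addr_gt0 K0 K0))).
  apply: ae_ge0_le_integral => //.
  - move=> x _; rewrite lee_fin; apply: mulr_ge0; last by lra.
    by rewrite divr_ge0// fine_ge0.
  - apply/measurable_EFinP; apply: measurable_funM => //; exact: measurable_funM.
  - by move=> x _; exact: adde_ge0.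
  - apply: emeasurable_funD; apply/measurable_EFinP; apply: measurableT_comp => //;
    apply: measurable_funB => //; exact: measurable_process_integral.
  apply: filterS aeK => x AK _.
  rewrite !integral_dist_process -EFinD lee_fin.
  set D := Rintegral _ _ _; set c := \1_A x / _.
  have cK : c * K <= c * D.
    rewrite /c indicE; case: (boolP (x \in A)) => [/set_mem xA|_]; last first.
      by rewrite !mul0r.
    by apply: ler_wpM2l; [rewrite divr_ge0// fine_ge0|exact: AK].
  have := ler_norm (- (-1 * c * D - S x)); rewrite normrN.
  have := ler_norm (1 * c * D - S x).
  by move: cK; rewrite !mul1r !mulN1r mulNr mulrDr; lra.
move: hsum; case: (e) => [r| |]; rewrite ?leey// -?EFinD ?lee_fin//.
lra.
Qed.

(** The event may change with [e]: it will be a shrinking neighbourhood of a value that [tau] may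
    take with probability 0. *)
Lemma optimal_error_ge j (taus : 'I_j.+1 -> random_time P) y K :
  (forall k : 'I_j.+1, taus k = y k) ->
  (forall e, 0 < e -> exists A : set T, [/\ measurable A, (0 < P A)%E &
    {ae P, forall x, A x ->
     K - e <= \int[mu]_(t in `[0, 1]) v (near_dist (fun k => y k x) j t)}]) ->
  (K%:E <= optimal_error w taus)%E.
Proof.
move=> tausE H; apply/lee_subgt0Pr => e e0; have [A [mA A0 aeA]] := H e e0.
by rewrite -EFinB; exact: optimal_error_ge_on aeA.
Qed.

End lower_bound.

(** * Shifts of a random time *)

Section shifts.
Context {R : realType} {d : measure_display} {T : measurableType d}
        (P : probability T R).
Variables (w : R -> R) (hw : concave_modulus w) (tau : random_time P).
Local Notation I := (primitive_modulus w).
Local Notation m := (time_ess_inf tau).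
Local Notation M := (time_ess_sup tau).

Lemma ess_sup_time : ess_sup P (fun x => (tau x)%:E) = M%:E.
Proof.
rewrite /time_ess_sup fineK//.
have l1 : (ess_sup P (fun x => (tau x)%:E) <= 1%:E)%E.
  by apply: ess_sup_ler => x; rewrite lee_fin; case/andP: (time_itv tau x).
have l0 : (0 <= ess_sup P (fun x => (tau x)%:E))%E.
  apply: ess_sup_ger; first by rewrite [ltRHS](@probability_setT _ _ _ P) lte01.
  by move=> x; rewrite lee_fin; case/andP: (time_itv tau x).
by rewrite ge0_fin_numE// (le_lt_trans l1)// ltry.
Qed.

Lemma ess_inf_time : ess_inf P (fun x => (tau x)%:E) = m%:E.
Proof.
rewrite /time_ess_inf fineK//.
have l0 : (0 <= ess_inf P (fun x => (tau x)%:E))%E.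
  by apply: ess_inf_ler => x; rewrite lee_fin; case/andP: (time_itv tau x).
have l1 : (ess_inf P (fun x => (tau x)%:E) <= 1%:E)%E.
  rewrite ess_infEN leeNl; apply: ess_sup_gee.
    by rewrite [ltRHS](@probability_setT _ _ _ P) lte01.
  by apply: aeW => x; rewrite leeN2 lee_fin; case/andP: (time_itv tau x).
by rewrite ge0_fin_numE// (le_lt_trans l1)// ltry.
Qed.

Lemma time_ess_sup_le c : {ae P, forall x, tau x <= c} -> M <= c.
Proof.
move=> h; rewrite -lee_fin -ess_sup_time; apply/ess_supP.
by apply: filterS h => x; rewrite lee_fin.
Qed.

Lemma time_ess_inf_ge c : {ae P, forall x, c <= tau x} -> c <= m.
Proof.
move=> h; rewrite -lee_fin -ess_inf_time; apply/ess_infP.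
by apply: filterS h => x; rewrite lee_fin.
Qed.

Lemma time_ess_bounds : {ae P, forall x, m <= tau x <= M}.
Proof.
apply: filterS2 (ess_inf_le P (fun x => (tau x)%:E))
  (ess_sup_ge P (fun x => (tau x)%:E)) => x.
by rewrite ess_inf_time ess_sup_time !lee_fin => -> ->.
Qed.

Lemma time_ess_order : [/\ 0 <= m, m <= M & M <= 1].
Proof.
split.
- by apply: time_ess_inf_ge; apply: aeW => x; case/andP: (time_itv tau x).
- rewrite -lee_fin -ess_sup_time; apply: ess_sup_gee.
    by rewrite [ltRHS](@probability_setT _ _ _ P) lte01.
  by apply: filterS time_ess_bounds => x /andP[mt _]; rewrite lee_fin.
- by apply: time_ess_sup_le; apply: aeW => x; case/andP: (time_itv tau x).
Qed.

(** Membership of [c] in the support of the law of [tau]. *)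
Definition essential_value c :=
  forall e, 0 < e -> (0 < P [set x | `|tau x - c| <= e]%R)%E.

Lemma measurable_time_ball c e : measurable [set x | `|tau x - c| <= e].
Proof.
have mt : measurable_fun setT (fun x => `|tau x - c|).
  by apply: measurableT_comp => //; exact: measurable_funB.
have := mt measurableT _ (measurable_itv `]-oo, e]); rewrite setTI.
by congr measurable; apply/seteqP; split => x /=; rewrite in_itv.
Qed.

Lemma null_time_ball c e : ~~ (0 < P [set x | `|tau x - c| <= e]%R)%E ->
  {ae P, forall x, e < `|tau x - c|}.
Proof.
rewrite -leNgt => le0; exists [set x | `|tau x - c| <= e]; split.
- exact: measurable_time_ball.
- by apply/eqP; rewrite eq_le le0 measure_ge0.
- by move=> x /= /negP; rewrite -leNgt.
Qed.

Lemma essential_value_sup : essential_value M.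
Proof.
move=> e e0; apply/negPn/negP => /null_time_ball H.
suff : M <= M - e by lra.
apply: time_ess_sup_le; apply: filterS2 H time_ess_bounds => x + /andP[_ tM].
by rewrite ler0_norm; lra.
Qed.

Lemma essential_value_inf : essential_value m.
Proof.
move=> e e0; apply/negPn/negP => /null_time_ball H.
suff : m + e <= m by lra.
apply: time_ess_inf_ge; apply: filterS2 H time_ess_bounds => x + /andP[tM _].
by rewrite ger0_norm; lra.
Qed.

Section admissible_shifts.
Variables (j : nat) (t : 'I_j.+1 -> R).
Hypothesis adm : admissible tau t.

Lemma admissible_le (i k : 'I_j.+1) : (i <= k)%N -> t i <= t k.
Proof.
have [_ inc _] := adm; rewrite leq_eqVlt => /predU1P[ik|/inc/ltW//].
by have -> : i = k by exact: val_inj.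
Qed.

Lemma admissible_sup : M + t ord_max <= 1.
Proof.
have [_ _ last] := adm; rewrite -lerBrDr; apply: time_ess_sup_le.
by apply: filterS (last ord_max erefl) => x; lra.
Qed.

Lemma admissible_ge0 k : 0 <= t k.
Proof. by have [/(_ ord0 erefl) <- _ _] := adm; exact: admissible_le. Qed.

(** The truncation in [shift_fun] is almost everywhere inactive, as [0 <= t k <= t ord_max] and
    [M + t ord_max <= 1]. *)
Lemma shift_time_ae : {ae P, forall x k, shift_time tau (t k) x = tau x + t k}.
Proof.
apply: filterS time_ess_bounds => x /andP[_ tM] k.
have := admissible_ge0 k; have := @admissible_le k ord_max (ltn_ord k).
have := admissible_sup; have /andP[? ?] := time_itv tau x => *.
by rewrite /= /shift_fun -/(clip _) clip_id//; apply/andP; split; lra.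
Qed.

(** The adversary lives where [tau] is close to [c]; a bound that deteriorates linearly in [|u - c|]
    is enough, as the radius absorbs the loss. *)
Lemma shift_error_ge c C K h : essential_value c -> 0 <= C -> 0 <= h ->
  (forall u, 0 <= u -> u + t ord_max <= 1 -> K - C * `|u - c| <=
     I u + (t ord_max * w h + 2 * j%:R * (I h - h * w h)) + I (1 - (u + t ord_max))) ->
  (K%:E <= shift_error w tau t)%E.
Proof.
move=> hc C0 h0 HK.
pose y k := shift_time tau (t (inord k)).
apply: (@optimal_error_ge _ _ _ _ _ hw _ _ y).
  by move=> k; rewrite /y inord_val.
move=> e e0; have C1 : 0 < C + 1 by lra.
(* The loss on this event is at most [C * (e / (C + 1)) <= e]; the added 1 keeps the denominator
   positive when [C = 0]. *)
exists [set x | `|tau x - c| <= e / (C + 1)]; split.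
- exact: measurable_time_ball.
- by apply: hc; rewrite divr_gt0.
have bnd : {ae P, forall x, tau x <= M} by apply: filterS time_ess_bounds => x /andP[].
apply: filterS2 shift_time_ae bnd => x xE xM /= xc.
have yE k : y k x = tau x + t (inord k) by rewrite /y xE.
have t0 : t (inord 0) = 0.
  by have [h00 _ _] := adm; apply: h00; rewrite inordK.
have tj : inord j = ord_max :> 'I_j.+1 by apply: val_inj; rewrite /= inordK.
have /andP[u0 u1] := time_itv tau x; have sup := admissible_sup.
have ynd i k : (i <= k <= j)%N -> y i x <= y k x.
  move=> /andP[ik kj]; rewrite !yE lerD2l admissible_le// !inordK//.
  exact: leq_ltn_trans ik _.
have := @near_dist_integral_ge _ _ hw (fun k => y k x) j ynd h h0.
rewrite !yE t0 tj addr0 => /(_ u0 ltac:(lra)); apply: le_trans.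
have -> : tau x + t ord_max - tau x = t ord_max by lra.
apply: le_trans (HK (tau x) u0 ltac:(lra)); rewrite lerD2l lerN2.
apply: (@le_trans _ _ (C * (e / (C + 1)))); first exact: ler_wpM2l.
by rewrite mulrA ler_pdivrMr//; lra.
Qed.

End admissible_shifts.

(** The alternatives confine to [[l, Mu]] the length of the left end piece, [tau], or of the right
    one, [1 - 2 * j * h - tau]. *)
Lemma shift_error_le j (t : nat -> R) h Mu l : (forall k, t k = 2 * k%:R * h) ->
  0 <= h -> 0 <= l -> 0 <= Mu -> l + Mu + 2 * j%:R * h = 1 ->
  M + 2 * j%:R * h <= 1 ->
  l <= m /\ M <= Mu \/ l <= 1 - 2 * j%:R * h - M /\ 1 - 2 * j%:R * h - m <= Mu ->
  (shift_error w tau (fun k : 'I_j.+1 => t k) <= (I Mu + I l + 2 * j%:R * I h)%:E)%E.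
Proof.
move=> tE h0 l0 Mu0 e Mj alt.
have good : {ae P, forall x k, (k <= j)%N ->
    shift_time tau (t k) x = tau x + 2 * k%:R * h}.
  apply: filterS time_ess_bounds => x /andP[_ xM] k kj.
  have /andP[u0 u1] := time_itv tau x.
  have k0 : 0 <= k%:R * h by rewrite mulr_ge0.
  have kj' : k%:R * h <= j%:R * h by rewrite ler_wpM2r// ler_nat.
  by rewrite /= /shift_fun -/(clip _) tE clip_id//; apply/andP; split; lra.
apply: (@optimal_error_le _ _ _ _ _ hw _ _ (fun k => shift_time tau (t k))) => //.
  apply: filterS good => x xE k kj; rewrite !xE ?(ltnW kj)//.
  by rewrite -natr1; lra.
case: alt => -[a1 a2]; [left|right];
  apply: filterS2 good time_ess_bounds => x xE /andP[mx xM]; rewrite xE//.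
- by rewrite mulr0 mul0r addr0; apply/andP; split; lra.
- by apply/andP; split; lra.
Qed.

(** For a single node the strict monotonicity is void and [h] may be 0. *)
Lemma admissible_uniform j (t : 'I_j.+1 -> R) h : (forall k, t k = 2 * k%:R * h) ->
  ((0 < j)%N -> 0 < h) -> M + 2 * j%:R * h <= 1 -> admissible tau t.
Proof.
move=> tE h0 Mj; split.
- by move=> k k0; rewrite tE k0 mulr0 mul0r.
- move=> i k ik; rewrite !tE ltr_pM2r ?ltr_pM2l ?ltr_nat//.
  by apply: h0; have := ltn_ord k; lia.
- move=> k [kj]; apply: filterS time_ess_bounds => x /andP[_ xM].
  by rewrite tE kj; lra.
Qed.

Lemma inf_shift_errorE n (t : 'I_n -> R) K : admissible tau t ->
  (shift_error w tau t <= K%:E)%E ->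
  (forall s : 'I_n -> R, admissible tau s -> (K%:E <= shift_error w tau s)%E) ->
  inf_shift_error w n tau = K%:E /\ inf_shift_error_attained w tau t.
Proof.
move=> adm le ge.
have E : inf_shift_error w n tau = K%:E.
  apply/eqP; rewrite eq_le; apply/andP; split.
    by apply: le_trans le; apply: ereal_inf_lbound; exists t.
  by apply: le_ereal_inf_tmp => _ [s sadm <-]; exact: ge.
split => //; split => //; rewrite E; apply/eqP; rewrite eq_le le/=.
exact: ge.
Qed.

(* Cases 1 and 2: the end piece on the other side has the length [h] of a
   half-gap. *)
Lemma shift_error_ge_one_end j (t : 'I_j.+1 -> R) c h : admissible tau t ->
  essential_value c -> 0 <= c -> 0 <= h -> (2 * j%:R + 1) * h = 1 - c ->
  (((2 * j%:R + 1) * I h + I c)%:E <= shift_error w tau t)%E.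
Proof.
move=> adm hc c0 h0 e.
have wc := modulus_ge0 hw c0; have wh := modulus_ge0 hw h0.
apply: (shift_error_ge adm hc (C := w c + w h) (h := h)) => //.
  by rewrite addr_ge0.
move=> u u0 u1.
(* Tangents of [I] at [c] and at [h]. The terms in [t ord_max] cancel, and by [e] the remainder is
   [(w c - w h) * (u - c)]. *)
have := primitive_modulus_tangent hw c0 u0.
have := primitive_modulus_tangent hw h0 (y := 1 - (u + t ord_max)).
move=> /(_ ltac:(lra)) T1 T2.
have n1 : w c * (c - u) <= w c * `|u - c| by rewrite ler_wpM2l// distrC ler_norm.
have n2 : w h * (u - c) <= w h * `|u - c| by rewrite ler_wpM2l// ler_norm.
have e' : 2 * j%:R * h * w h = (1 - c - h) * w h by rewrite -e; lra.
lra.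
Qed.

(** Tangents of [I] at [c] for the left end, at [c'] for the right end and at [h] for the gaps leave
    [(w c' - w h) * (1 - t ord_max - c - c')] plus a multiple of [u - c]; the sign hypothesis
    discards the former. *)
Lemma shift_error_ge_two_ends j (t : 'I_j.+1 -> R) c c' h : admissible tau t ->
  essential_value c -> 0 <= c -> 0 <= c' -> 0 <= h -> 2 * j%:R * h = 1 - c - c' ->
  0 <= (w c' - w h) * (1 - t ord_max - c - c') ->
  ((2 * j%:R * I h + I c + I c')%:E <= shift_error w tau t)%E.
Proof.
move=> adm hc c0 c'0 h0 e s.
have wc := modulus_ge0 hw c0; have wc' := modulus_ge0 hw c'0.
apply: (shift_error_ge adm hc (C := w c + w c') (h := h)) => //.
  by rewrite addr_ge0.
move=> u u0 u1.
have := primitive_modulus_tangent hw c0 u0.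
have := primitive_modulus_tangent hw c'0 (y := 1 - (u + t ord_max)).
move=> /(_ ltac:(lra)) T1 T2.
have n1 : w c * (c - u) <= w c * `|u - c| by rewrite ler_wpM2l// distrC ler_norm.
have n2 : w c' * (u - c) <= w c' * `|u - c| by rewrite ler_wpM2l// ler_norm.
have e' : 2 * j%:R * h * w h = (1 - c - c') * w h by rewrite -e; lra.
lra.
Qed.

End shifts.

(** * The choice of the half-gap in the three cases *)

Theorem theorem3 (R : realType) (d : measure_display) (T : measurableType d)
    (P : probability T R) (w : R -> R) (hw : concave_modulus w)
    (n : nat) (hn : (0 < n)%N) (tau : random_time P)
    (hex : exists t : 'I_n -> R, admissible tau t) :
  let I := primitive_modulus w in
  let m := time_ess_inf tau in
  let M := time_ess_sup tau in
  let N : R := n%:R in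
  [/\ (2 * N - 1) * m + M >= 1 ->
        inf_shift_error w n tau =
          ((2 * N - 1) * I ((1 - M) / (2 * N - 1)) + I M)%:E /\
        inf_shift_error_attained w tau
          (fun k : 'I_n => 2 * k%:R * (1 - M) / (2 * N - 1)),
      (2 * N - 1) * M + m <= 1 ->
        inf_shift_error w n tau =
          ((2 * N - 1) * I ((1 - m) / (2 * N - 1)) + I m)%:E /\
        inf_shift_error_attained w tau
          (fun k : 'I_n => 2 * k%:R * (1 - m) / (2 * N - 1)) &
      ~ ((2 * N - 1) * m + M >= 1) -> ~ ((2 * N - 1) * M + m <= 1) ->
        inf_shift_error w n tau =
          ((2 * N - 2) * I ((1 - m - M) / (2 * N - 2)) + I m + I M)%:E /\
        inf_shift_error_attained w tau
          (fun k : 'I_n => k%:R * (1 - m - M) / (N - 1))].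
Proof.
case: n hn hex => [//|j] _ [t0 adm0] I m M N.
have NE : N = j%:R + 1 by rewrite /N -natr1.
have [m0 mM M1] : [/\ 0 <= m, m <= M & M <= 1] := time_ess_order tau.
have J0 : 0 <= j%:R :> R by [].
(* With two nodes or more the last shift is positive, so the existence of an admissible choice
   forces [M < 1] and the half-gaps are positive. *)
have jM : (0 < j)%N -> M < 1.
  move=> jpos; have := admissible_sup adm0.
  have [t00 inc _] := adm0.
  have : t0 ord0 < t0 ord_max by exact: inc.
  by rewrite t00// /M; lra.
have N1 : 2 * N - 1 = 2 * j%:R + 1 by rewrite NE; lra.
have D0 : 0 < 2 * j%:R + 1 :> R by lra.
rewrite N1; split.
- move=> c1; pose h := (1 - M) / (2 * j%:R + 1).
  have he : (2 * j%:R + 1) * h = 1 - M by rewrite mulrC mulfVK// gt_eqF.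
  have h0 : 0 <= h by rewrite divr_ge0// ?subr_ge0// ltW.
  have hm : h <= m by rewrite ler_pdivrMr//; lra.
  have tE k : 2 * k%:R * (1 - M) / (2 * j%:R + 1) = 2 * k%:R * h by rewrite mulrA.
  apply: inf_shift_errorE.
  + apply: (@admissible_uniform _ _ _ _ _ _ _ h) => //.
      by move=> /jM M1'; rewrite divr_gt0// subr_gt0.
    by rewrite -/M; lra.
  (* By [hm] the left end piece [tau] ranges in [[h, M]], and [h + M + 2 * j * h = 1]. *)
  + apply: (le_trans (shift_error_le hw (h := h) (Mu := M) (l := h) tE
      _ _ _ _ _ _)) => //.
    * exact: le_trans mM.
    * lra.
    * by rewrite -/M; lra.
    * by left.
    * by rewrite lee_fin /I -/h; lra.
  + move=> s sadm; apply: (shift_error_ge_one_end hw sadm (c := M)) => //.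
      exact: essential_value_sup.
    exact: le_trans mM.
- move=> c2; pose h := (1 - m) / (2 * j%:R + 1).
  have he : (2 * j%:R + 1) * h = 1 - m by rewrite mulrC mulfVK// gt_eqF.
  have h0 : 0 <= h by rewrite divr_ge0//; lra.
  have hm : M <= h by rewrite ler_pdivlMr//; lra.
  have tE k : 2 * k%:R * (1 - m) / (2 * j%:R + 1) = 2 * k%:R * h by rewrite mulrA.
  apply: inf_shift_errorE.
  + apply: (@admissible_uniform _ _ _ _ _ _ _ h) => //.
      by move=> /jM M1'; rewrite divr_gt0//; lra.
    by rewrite -/M; lra.
  (* The right end piece has length [h + m - tau], which by [hm] ranges in [[m, h]]. *)
  + apply: (le_trans (shift_error_le hw (h := h) (Mu := h) (l := m) tE
      _ _ _ _ _ _)) => //.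
    * lra.
    * by rewrite -/M; lra.
    * by right; rewrite -/m -/M; lra.
    * by rewrite lee_fin /I -/h; lra.
  + move=> s sadm; apply: (shift_error_ge_one_end hw sadm (c := m)) => //.
    exact: essential_value_inf.
- move=> /negP; rewrite -ltNge => c1 /negP; rewrite -ltNge => c2.
  (* For a single node the two negated conditions read [m + M < 1] and [M + m > 1]. *)
  have j0 : (0 < j)%N.
    by rewrite lt0n; apply/negP => /eqP j00; move: c1 c2; rewrite j00; lra.
  have J1 : 0 < j%:R :> R by rewrite ltr0n.
  have -> : 2 * N - 2 = 2 * j%:R by rewrite NE; lra.
  have -> : N - 1 = j%:R by rewrite NE; lra.
  pose h := (1 - m - M) / (2 * j%:R).
  have he : 2 * j%:R * h = 1 - m - M by rewrite mulrC mulfVK// gt_eqF// mulr_gt0.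
  have D2 : 0 < 2 * j%:R :> R by lra.
  have Jm : 0 <= j%:R * m by rewrite mulr_ge0.
  have h0 : 0 < h by rewrite divr_gt0//; lra.
  have mh : m <= h by rewrite ler_pdivlMr//; lra.
  have hM : h <= M by rewrite ler_pdivrMr//; lra.
  have tE k : k%:R * (1 - m - M) / j%:R = 2 * k%:R * h.
    rewrite /h invfM; rewrite [RHS](_ : _ = (2 * 2^-1) * (k%:R * (1 - m - M) / j%:R)).
      by rewrite divff ?mul1r// pnatr_eq0.
    by lra.
  apply: inf_shift_errorE.
  + apply: (@admissible_uniform _ _ _ _ _ _ _ h) => //.
    by rewrite -/M; lra.
  + apply: (le_trans (shift_error_le hw (h := h) (Mu := M) (l := m) tE
      _ _ _ _ _ _)) => //.
    * exact: ltW.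
    * exact: le_trans mM.
    * lra.
    * by rewrite -/M; lra.
    * by left.
    * by rewrite lee_fin /I -/h; lra.
  + move=> s sadm; have hh := ltW h0; have MM0 := le_trans m0 mM.
    have wm : w m <= w h by exact: (modulus_ndecr hw).
    have wM : w h <= w M by exact: (modulus_ndecr hw).
    (* Since [w m <= w h <= w M], the sign of [1 - s ord_max - m - M] decides at which extreme of
       [tau] the adversary acts: at [M] with [c' = m], or at [m] with [c' = M]. *)
    have [L|L] := leP (1 - s ord_max) (m + M).
    * have := @shift_error_ge_two_ends _ _ _ _ _ hw tau j s M m h sadm.
      have -> : 2 * j%:R * primitive_modulus w h + primitive_modulus w M +
          primitive_modulus w m =
          2 * j%:R * I ((1 - m - M) / (2 * j%:R)) + I m + I M.
        by rewrite /I -/h; lra.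
      apply => //; [exact: essential_value_sup|lra|].
      by rewrite mulr_le0// ?subr_le0//; lra.
    * apply: (shift_error_ge_two_ends hw sadm (c := m) (c' := M)) => //.
        exact: essential_value_inf.
      by rewrite mulr_ge0// ?subr_ge0//; lra.
Qed.
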